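(* There exists an absolute constant $C>0$ such that the following holds. Let $d\in\mathbb{N}$ and let $F$ be a symmetric probability distribution on $\mathbb{R}^d$ with $\operatorname{supp}F\subset\mathbb{Z}^d$ and $q:=F\{\vec 0\}\in(0,1)$. Then, for any $n\in\mathbb{N}$, $$d_{TV}\big(F^{*n},\exp(n(F-I))\big)\leq \frac{C(1+\delta^2(n))}{n\,q^{7/2}}.$$
   Context: Symmetric means $F\{\vec x\}=F\{-\vec x\}$ for all $\vec x\in\mathbb{Z}^d$. $I$ is the distribution concentrated at $\vec 0\in\mathbb{R}^d$; $*$ is convolution of finite signed measures on $\mathbb{R}^d$; $M^{*j}$ is the $j$-fold convolution power, $M^{*0}=I$; $\exp(M)=\sum_{j\ge 0}M^{*j}/j!$. Total variation distance: $d_{TV}(F,G)=\sup_B|F\{B\}-G\{B\}|=\frac12\|F-G\|_{TV}$ (supremum over Borel sets of $\mathbb{R}^d$); for measures supported on $\mathbb{Z}^d$, $\|M\|_{TV}=\sum_{\vec m\in\mathbb{Z}^d}|M\{\vec m\}|$. With $p_{\vec x}=F\{\vec x\}$, for $y>0$, $$\delta(y)=\sum_{\vec x\in \operatorname{supp}F\setminus\{\vec 0\}}\min(1,\,4y\,p_{\vec x}),$$ and $\delta^2(y)=(\delta(y))^2$. *)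

(* Defs.v *)
From HB Require Import structures.
From mathcomp Require Import all_boot all_order all_algebra.
From mathcomp Require Import all_classical all_reals all_analysis.

Set Implicit Arguments.
Unset Strict Implicit.
Unset Printing Implicit Defensive.

Import Order.TTheory GRing.Theory Num.Theory.
Import numFieldNormedType.Exports.

Local Open Scope classical_set_scope.
Local Open Scope ring_scope.
Local Open Scope ereal_scope.

(* R^d, as row vectors, with its Borel sigma-algebra. *)
Definition Rd (R : realType) (d : nat) := g_sigma_algebraType (@open 'rV[R]_d).

(* Z^d inside R^d. *)
Definition lattice (R : realType) (d : nat) : set (Rd R d) :=
  [set x : 'rV[R]_d | forall i, x ord0 i \is a Num.int].

(* Topological support of a Borel measure. *)
Definition supp (R : realType) (d : nat) (mu : set (Rd R d) -> \bar R) :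
    set (Rd R d) :=
  [set x : 'rV[R]_d | forall U : set 'rV[R]_d, open U -> U x -> 0 < mu U].

Definition symmetric_on_lattice (R : realType) (d : nat)
    (mu : set (Rd R d) -> \bar R) : Prop :=
  forall x : 'rV[R]_d, lattice x -> mu [set x] = mu [set (- x)%R].

(* Integral against a finite signed measure, through its Jordan decomposition;
   it does not depend on the Hahn decomposition chosen
   (Hahn_decomposition_uniq). *)
Definition charge_integral (disp : measure_display) (T : measurableType disp)
    (R : realType) (M : {charge set T -> \bar R}) (f : T -> \bar R) : \bar R :=
  let: exist P hP := cid (Hahn_decomposition M) in
  let: exist N hPN := cid hP in
  \int[jordan_pos hPN]_x f x - \int[jordan_neg hPN]_x f x.

(* (A * M)(B) = \int A(B - y) M(dy), where B - y = {x | x + y \in B}. The left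
   factor is a mere set function, so that convolution can be iterated without
   first equipping A * M with a charge structure. *)
Definition convolve (R : realType) (d : nat) (A : set (Rd R d) -> \bar R)
    (M : {charge set (Rd R d) -> \bar R}) : set (Rd R d) -> \bar R :=
  fun B => charge_integral M
    (fun y : 'rV[R]_d => A [set x : 'rV[R]_d | B (x + y)%R]).

(* The distribution I concentrated at the origin. *)
Definition unit_mass (R : realType) (d : nat) :
    {finite_measure set (Rd R d) -> \bar R} :=
  @dirac _ (Rd R d) (0%R : 'rV[R]_d) R.

Fixpoint conv_pow (R : realType) (d : nat)
    (M : {charge set (Rd R d) -> \bar R}) (j : nat) : set (Rd R d) -> \bar R :=
  if j is j'.+1 then convolve (conv_pow M j') M else @unit_mass R d.

(* The exponential series, evaluated set by set. *)
Definition conv_exp (R : realType) (d : nat)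
    (M : {charge set (Rd R d) -> \bar R}) : set (Rd R d) -> \bar R :=
  fun B => \sum_(0 <= j <oo) ((j`!%:R)^-1)%:E * conv_pow M j B.

(* n (F - I) *)
Definition accompanying_exponent (R : realType) (d : nat)
    (F : probability (Rd R d) R) (n : nat) : {charge set (Rd R d) -> \bar R} :=
  cscale n%:R (cadd (charge_of_finite_measure F)
                    (copp (charge_of_finite_measure (@unit_mass R d)))).

Definition dTV (R : realType) (d : nat) (A B : set (Rd R d) -> \bar R) :
    \bar R :=
  ereal_sup [set `| A S - B S | | S in (measurable : set (set (Rd R d)))].

Definition delta (R : realType) (d : nat) (F : probability (Rd R d) R) (y : R) :
    \bar R :=
  \esum_(x in supp F `\ (0%R : 'rV[R]_d))
    (Num.min 1 (4 * y * fine (F [set x]))%R)%:E.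

(* Main.v *)
Require Import Defs.
From HB Require Import structures.
From mathcomp Require Import all_boot all_order all_algebra.
From mathcomp Require Import all_classical all_reals all_analysis.
From mathcomp Require Import measurable_realfun simple_functions.
From mathcomp Require Import zify ring lra.

(** A measure [M] acts on bounded functions by [(M g)(y) = \int g(y + z) M(dz)],
    and [M^{*j}(B) = (M^j 1_B)(0)]; so it is enough to bound the operator norm
      of
    [F^n - exp(n(F - I))], where [F] also denotes the operator (called [avg]).

    Smoothing.  Let [E_x] be the translation by [x], [S_x = E_x + E_{-x} - 2]
      and
    [V_x = (2 + E_x + E_{-x}) / 4].  As [S_x V_x^j] is a second difference of
    binomial weights, its norm is at most [8 / (j + 1)].  Since [F] dominates
    [q I + p_x (E_x + E_{-x})], one may write [F = a V_x + G] with [a = 4 q p_x]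
    and [|G| <= 1 - a]; averaging over the binomial number of factors [V_x] in
    [F^k] gives [|S_x F^k| <= 2 / (q p_x (k + 1))].  By symmetry
    [F - I = 1/2 \sum_x p_x S_x], whence
    [|(F - I) F^k| <= delta(n) / (q (k + 1))] for [k <= n], and
    [|(F - I)^2 F^k| <= 4 delta(n)^2 / (q^2 (k + 1)(k + 2))].

    Comparison.  [(I + n (F - I) / m)^m] is a binomial mixture with mean [n] of
    the powers [F^k].  The second order Taylor remainder of [F^k] at [F^n] is at
    most [(k - n)^2 |(F - I)^2 F^{min(k, n)}|]; averaging it gives
    [32 delta(n)^2 / (n q^2)], uniformly in [m], and [m] tends to infinity. *)

Set Implicit Arguments.
Unset Strict Implicit.
Unset Printing Implicit Defensive.

Import Order.TTheory GRing.Theory Num.Theory.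
Import numFieldNormedType.Exports.

Local Open Scope ring_scope.

(** * Averages over the binomial distribution *)

Section BinomialMean.
Variables (R : realFieldType) (t : R).

(** The mean of [f] under the binomial law with [m] trials and success probability [t], by
    conditioning on one trial. Values in a module let it apply both to numbers and to polynomials in
    an operator. *)
Fixpoint binmean (U : lmodType R) (m : nat) (f : nat -> U) : U :=
  if m is m'.+1 then
    (1 - t) *: binmean m' f + t *: binmean m' (fun k => f k.+1)
  else f 0%N.

Lemma eq_binmean (U : lmodType R) m (f g : nat -> U) :
  f =1 g -> binmean m f = binmean m g.
Proof.
by elim: m f g => [|m IH] f g fg /=; [exact: fg|congr (_ *: _ + _ *: _);
  apply: IH].
Qed.

Lemma binmeanD (U : lmodType R) m (f g : nat -> U) :
  binmean m (fun k => f k + g k) = binmean m f + binmean m g.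
Proof.
by elim: m f g => [|m IH] f g //=; rewrite !IH !scalerDr addrACA.
Qed.

Lemma binmean_cst (U : lmodType R) m (c : U) : binmean m (fun=> c) = c.
Proof. by elim: m => //= m ->; rewrite -scalerDl subrK scale1r. Qed.

Lemma binmeanZl (U : lmodType R) m (f : nat -> R^o) (c : U) :
  binmean m (fun k => f k *: c) = binmean m f *: c.
Proof.
by elim: m f => [|m IH] f //=; rewrite !IH [RHS]scalerDl !scalerA.
Qed.

Lemma binmeanM m (f : nat -> R^o) c :
  binmean m (fun k => f k * c : R^o) = binmean m f * c.
Proof. exact: (binmeanZl m f (c : R^o)). Qed.

Lemma binmean_le m (f g : nat -> R^o) : 0 <= t <= 1 ->
  (forall k, f k <= g k) -> (binmean m f : R) <= binmean m g.
Proof.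
move=> /andP[t0 t1]; elim: m f g => [|m IH] f g fg /=; first exact: fg.
by apply: lerD; apply: ler_wpM2l; rewrite ?subr_ge0 ?IH.
Qed.

(** Probability generating function of the binomial law. The offset [a] absorbs the shift [k.+1] in
    the induction. *)
Lemma binmean_exp (x : {poly R}) m a :
  binmean m (fun k => x ^+ (a + k)) = x ^+ a * (1 + t *: (x - 1)) ^+ m.
Proof.
elim: m a => [|m IH] a; first by rewrite /= addn0 mulr1.
have -> : binmean m.+1 (fun k => x ^+ (a + k)) =
    (1 - t) *: binmean m (fun k => x ^+ (a + k)) +
    t *: binmean m (fun k => x ^+ (a.+1 + k)).
  by congr (_ + _ *: _); apply: eq_binmean => k; rewrite addSnnS.
rewrite !IH -!mul_polyC polyCB !exprS.
move: ((1 + t%:P * (x - 1)) ^+ m) (x ^+ a) (t%:P) => P Q T.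
by rewrite polyC1; ring.
Qed.

Lemma binmean_id m : binmean m (fun k => k%:R : R^o) = m%:R * t.
Proof.
elim: m => [|m IH] /=; first by rewrite mul0r.
rewrite (@eq_binmean _ m (fun k => k.+1%:R : R^o) (fun k => (k%:R : R^o) + 1)).
  by rewrite binmeanD binmean_cst IH -natr1 /GRing.scale/=; ring.
by move=> k; rewrite -natr1.
Qed.

(** Variance plus squared bias; [c] is general because a success replaces it by [c - 1]. *)
Lemma binmean_sqr_dist m c :
  binmean m (fun k => (k%:R - c) ^+ 2 : R^o) =
  m%:R * t * (1 - t) + (m%:R * t - c) ^+ 2.
Proof.
elim: m c => [|m IH] c /=; first by ring.
rewrite (@eq_binmean _ m (fun k => (k.+1%:R - c) ^+ 2 : R^o)
  (fun k => (k%:R - (c - 1)) ^+ 2 : R^o)); last first.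
  by move=> k; rewrite -natr1; congr (_ ^+ 2); ring.
by rewrite !IH -natr1 /GRing.scale/=; ring.
Qed.

(* Size biasing: [k C(m+1,k) = (m+1) C(m,k-1)]. *)
Lemma binmean_size_bias m (f : nat -> R^o) :
  binmean m.+1 (fun k => k%:R * f k.-1 : R^o) = m.+1%:R * t * binmean m f.
Proof.
elim: m f => [|m IH] f; first by rewrite /= /GRing.scale/=; ring.
have -> : forall g : nat -> R^o, binmean m.+2 g =
    (1 - t) * binmean m.+1 g + t * binmean m.+1 (fun k => g k.+1) by [].
have e : (fun k => k.+1%:R * f k.+1.-1 : R^o) =1
    (fun k => (k%:R * (f k.-1.+1) : R^o) + f k).
  by case=> [|k] /=; rewrite -natr1 ?mul0r; ring.
rewrite (eq_binmean _ e) binmeanD IH (IH (fun k => f k.+1)) /=.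
by rewrite -[in RHS]natr1 /GRing.scale/=; ring.
Qed.

(** Size biasing applied to [f k / k.+1] cancels the denominator; only the nonnegative term at
    [k = 0] is lost, hence an inequality. *)
Lemma binmean_inv m (f : nat -> R^o) : 0 < t <= 1 ->
  (forall k, 0 <= f k) ->
  (binmean m (fun k => f k / k.+1%:R : R^o) : R) <=
  binmean m.+1 (fun k => f k.-1) / (m.+1%:R * t).
Proof.
move=> /andP[t0 t1] f0; rewrite ler_pdivlMr ?mulr_gt0 ?ltr0n// mulrC.
rewrite -binmean_size_bias; apply: binmean_le; first by rewrite (ltW t0).
case=> [|k] /=; first by rewrite mul0r f0.
by rewrite mulrCA divff ?mulr1// pnatr_eq0.
Qed.

Lemma binmean_inv_le m : 0 < t <= 1 ->
  (binmean m (fun k => k.+1%:R^-1 : R^o) : R) <= (m.+1%:R * t)^-1.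
Proof.
move=> t01; rewrite (@eq_binmean _ m _ (fun k => 1 / k.+1%:R : R^o)).
  by apply: le_trans (binmean_inv _ t01 _) _ => //; rewrite binmean_cst mul1r.
by move=> k; rewrite mul1r.
Qed.

(** Each use of [binmean_inv] trades one denominator for one more trial and a factor at most
    [1 / n]. What remains is a squared distance under [m.+2] trials, at most
    [n + 2 * t + 4 <= 7 * n]. *)
Lemma binmean_inv2_sqr_dist m n : 0 < t <= 1 -> m%:R * t = n%:R ->
  (0 < n)%N ->
  (binmean m (fun k => (k%:R - n%:R) ^+ 2 / (k.+1%:R * k.+2%:R) : R^o) : R)
  <= 7 / n%:R.
Proof.
move=> t01 mt n0; have [t0 t1] := andP t01.
have m1t : m.+1%:R * t = n%:R + t by rewrite -natr1 mulrDl mul1r mt.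
have m2t : m.+2%:R * t = n%:R + 2 * t by rewrite -natr1 mulrDl mul1r m1t; ring.
have n1 : 1 <= n%:R :> R by rewrite ler1n.
set f := fun k => (k%:R - n%:R) ^+ 2 / k.+2%:R : R^o.
rewrite (@eq_binmean _ m _ (fun k => f k / k.+1%:R)); last first.
  by move=> k; rewrite /f invfM mulrA mulrAC.
have f0 k : 0 <= f k by rewrite divr_ge0 ?sqr_ge0 ?ler0n.
apply: le_trans (binmean_inv _ t01 f0) _.
have le1 : (binmean m.+1 (fun k => f k.-1) : R) <=
    binmean m.+1 (fun k => (k%:R - (n%:R + 1)) ^+ 2 / k.+1%:R : R^o).
  apply: binmean_le; first by rewrite (ltW t0).
  (* At [k = 0] the truncated predecessor is again [0], so moving the centre from [n] to [n + 1]
     costs an inequality; for positive [k] both sides are equal. *)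
  case=> [|k] /=; rewrite /f.
    rewrite mulr1n divr1; apply: (@le_trans _ _ ((0 - n%:R) ^+ 2)).
      by rewrite ler_pdivrMr ?ltr0n// ler_peMr ?sqr_ge0// ler1n.
    by rewrite !sub0r !sqrrN lerXn2r ?nnegrE ?addr_ge0 ?ler01 ?lerDl//; lra.
  rewrite -[in X in _ <= (X%:R - _) ^+ 2 / _]addn1 natrD.
  by rewrite le_eqVlt; apply/orP; left; apply/eqP; congr (_ ^+ 2 / _); ring.
have {}le1 : (binmean m.+1 (fun k => f k.-1) : R) <=
    binmean m.+2 (fun k => (k%:R - (n%:R + 2)) ^+ 2 : R^o) / (m.+2%:R * t).
  apply: le_trans le1 _.
  have g0 k : 0 <= ((k%:R - (n%:R + 1)) ^+ 2 : R^o) by rewrite sqr_ge0.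
  apply: le_trans (binmean_inv _ t01 g0) _.
  rewrite ler_pM2r ?invr_gt0 ?mulr_gt0 ?ltr0n//.
  apply: binmean_le; first by rewrite (ltW t0).
  case=> [|k] /=.
    by rewrite !sub0r !sqrrN lerXn2r ?nnegrE ?addr_ge0 ?ler01 ?lerDl//; lra.
  rewrite -[in X in _ <= (X%:R - _) ^+ 2]addn1 natrD.
  by rewrite le_eqVlt; apply/orP; left; apply/eqP; congr (_ ^+ 2); ring.
rewrite ler_pdivrMr ?mulr_gt0 ?ltr0n//; apply: le_trans le1 _.
rewrite binmean_sqr_dist m1t m2t ler_pdivrMr; last lra.
have nn : n%:R * n%:R^-1 = 1 :> R by rewrite divff// gt_eqF// ltr0n.
have -> : 7 / n%:R * (n%:R + t) * (n%:R + 2 * t) =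
  7 * (n%:R * n%:R^-1) * (n%:R + 3 * t) + 14 * t ^+ 2 * n%:R^-1 by ring.
rewrite nn; have : 0 <= n%:R^-1 :> R by rewrite invr_ge0 ler0n.
move=> ni; have := mulr_ge0 (sqr_ge0 t) ni.
by nra.
Qed.

End BinomialMean.

(** * Operators on bounded functions *)

Section BoundedFunctions.
Variables (R : realType) (V : Type).

Definition bounded_pred : {pred V -> R^o} :=
  fun f => `[< exists c : R, forall y, `|f y| <= c >].

Fact bounded_pred_submod : submod_closed bounded_pred.
Proof.
split=> [|a f g /asboolP[c fc] /asboolP[e ge]].
  by apply/asboolP; exists 0 => y; rewrite normr0.
apply/asboolP; exists (`|a| * c + e) => y; apply: le_trans (ler_normD _ _) _.
by rewrite lerD// normrM ler_wpM2l.
Qed.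

HB.instance Definition _ :=
  GRing.isSubmodClosed.Build R (V -> R^o) bounded_pred bounded_pred_submod.

Record bfun := BFun { bfun_val :> V -> R^o ; _ : bfun_val \in bounded_pred }.

HB.instance Definition _ := [isSub for bfun_val].
HB.instance Definition _ := [Choice of bfun by <:].
HB.instance Definition _ := [SubChoice_isSubLmodule of bfun by <:].

Definition bounded_by (g : bfun) (c : R) := forall y, `|g y| <= c.

Lemma mk_bounded (f : V -> R^o) (c : R) :
  (forall y, `|f y| <= c) -> f \in bounded_pred.
Proof. by move=> fc; apply/asboolP; exists c. Qed.

Lemma bounded_byP (g : bfun) : exists c, bounded_by g c.
Proof. by case: g => g gP; have /asboolP[c gc] := gP; exists c. Qed.

Lemma bfunP (f g : bfun) : f =1 g -> f = g.
Proof. by move=> fg; apply/val_inj/funext. Qed.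

Lemma bfunDE (f g : bfun) y : (f + g) y = f y + g y.
Proof. by []. Qed.

Lemma bfunNE (f : bfun) y : (- f) y = - f y.
Proof. by []. Qed.

Lemma bfunZE (a : R) (f : bfun) y : (a *: f) y = a * f y.
Proof. by []. Qed.

Lemma bfun_sumE I (r : seq I) P (f : I -> bfun) y :
  (\sum_(i <- r | P i) f i) y = \sum_(i <- r | P i) (f i y : R).
Proof. by elim/big_rec2: _ => // i u v _ <-. Qed.

Lemma bounded_byD g c h e :
  bounded_by g c -> bounded_by h e -> bounded_by (g + h) (c + e).
Proof. by move=> gc he y; apply: le_trans (ler_normD _ _) _; apply: lerD. Qed.

Lemma bounded_byZ a g c : bounded_by g c -> bounded_by (a *: g) (`|a| * c).
Proof. by move=> gc y; rewrite normrM ler_wpM2l. Qed.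

(** An operator-norm bound phrased through pointwise bounds, which avoids forming a supremum
    norm. *)
Definition norm_le (T : bfun -> bfun) (c : R) :=
  forall g b, bounded_by g b -> bounded_by (T g) (c * b).

Lemma eq_norm_le T U c : T =1 U -> norm_le T c -> norm_le U c.
Proof. by move=> TU Tc g b /Tc; rewrite TU. Qed.

Lemma norm_le_comp T c U e :
  norm_le T c -> norm_le U e -> norm_le (T \o U) (c * e).
Proof. by move=> Tc Ue g b gb; rewrite -mulrA; apply/Tc/Ue. Qed.

Lemma norm_leD T c U e :
  norm_le T c -> norm_le U e -> norm_le (fun g => T g + U g) (c + e).
Proof.
by move=> Tc Ue g b gb; rewrite mulrDl; apply: bounded_byD; [apply: Tc|apply:
  Ue].
Qed.

Lemma norm_leZ a T c : norm_le T c -> norm_le (fun g => a *: T g) (`|a| * c).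
Proof. by move=> Tc g b gb; rewrite -mulrA; apply/bounded_byZ/Tc. Qed.

Lemma norm_le_weak T c e : c <= e -> norm_le T c -> norm_le T e.
Proof.
move=> ce Tc g b gb y; apply: le_trans (Tc g b gb y) _.
by rewrite ler_wpM2r// (le_trans _ (gb y)).
Qed.

Lemma norm_le_iter T k : norm_le T 1 -> norm_le (iter k T) 1.
Proof.
move=> T1; elim: k => [|k IH] g b gb; first by rewrite mul1r.
by rewrite iterS -[1]mul1r; apply: (norm_le_comp T1 IH).
Qed.

End BoundedFunctions.

Arguments bounded_by {R V} g c.
Arguments norm_le {R V} T c.

(** * Polynomial functional calculus of an operator *)

Section PolyAction.
Variables (R : realType) (B : lmodType R) (T : {linear B -> B}).

(** The operator [p(T)]. Identities between polynomials in [T] are thus proved in the commutative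
    ring [{poly R}], where [ring] applies. *)
Definition polyact (p : {poly R}) (g : B) : B :=
  \sum_(i < size p) p`_i *: iter i T g.

Lemma polyact_widen n (p : {poly R}) g : (size p <= n)%N ->
  polyact p g = \sum_(i < n) p`_i *: iter i T g.
Proof.
move=> pn; rewrite /polyact (big_ord_widen _ (fun i => p`_i *: iter i T g) pn).
rewrite big_mkcond; apply: eq_bigr => i _; case: ltnP => // pi.
by rewrite nth_default// scale0r.
Qed.

(** Arguments are swapped so that linearity in the polynomial can be registered as a structure. *)
Definition polyact_at g p := polyact p g.

Fact polyact_is_linear g : linear (polyact_at g).
Proof.
rewrite /polyact_at.
move=> a p q; pose n := maxn (size p) (size q).
rewrite !(@polyact_widen n) ?leq_maxl ?leq_maxr//; last first.
  apply: leq_trans (size_polyD _ _) _; rewrite geq_max leq_maxr andbT.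
  by rewrite (leq_trans (size_scale_leq _ _)) ?leq_maxl.
rewrite scaler_sumr -big_split; apply: eq_bigr => i _ /=.
by rewrite coefD coefZ scalerDl scalerA.
Qed.

HB.instance Definition _ g := GRing.isLinear.Build R {poly R} B _ (polyact_at g)
  (polyact_is_linear g).

Lemma polyactD p q g : polyact (p + q) g = polyact p g + polyact q g.
Proof. exact: (linearD (polyact_at g)). Qed.

Lemma polyactN p g : polyact (- p) g = - polyact p g.
Proof. exact: (linearN (polyact_at g)). Qed.

Lemma polyactZ a p g : polyact (a *: p) g = a *: polyact p g.
Proof. exact: (linearZZ (polyact_at g)). Qed.

Lemma polyact_sum I (r : seq I) P (p : I -> {poly R}) g :
  polyact (\sum_(i <- r | P i) p i) g = \sum_(i <- r | P i) polyact (p i) g.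
Proof. exact: (linear_sum (polyact_at g)). Qed.

Lemma polyactMX p g : polyact (p * 'X) g = polyact p (T g).
Proof.
rewrite (@polyact_widen (size p).+1) ?size_polyMX_leq//; last first.
  by rewrite (leq_trans (size_polyMleq _ _))// size_polyX addn2.
rewrite big_ord_recl coefMX scale0r add0r; apply: eq_bigr => i _.
by rewrite coefMX lift0 /= -iterSr.
Qed.

Lemma polyactC c g : polyact c%:P g = c *: g.
Proof.
rewrite (@polyact_widen 1) ?size_polyC ?leq_b1// big_ord1 coefC eqxx//.
Qed.

Lemma polyact1 g : polyact 1 g = g.
Proof. by rewrite polyactC scale1r. Qed.

Lemma polyactX g : polyact 'X g = T g.
Proof. by rewrite -['X]mul1r polyactMX polyact1. Qed.

Lemma polyactXn k g : polyact 'X^k g = iter k T g.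
Proof.
elim: k g => [|k IH] g; first by rewrite expr0 polyact1.
by rewrite exprSr polyactMX IH iterSr.
Qed.

Lemma polyact_argZ p a g : polyact p (a *: g) = a *: polyact p g.
Proof.
rewrite /polyact scaler_sumr; apply: eq_bigr => i _.
rewrite !scalerA mulrC -scalerA; congr (_ *: _).
by elim: (i : nat) => //= n ->; rewrite linearZZ.
Qed.

Lemma polyact_argD p g h : polyact p (g + h) = polyact p g + polyact p h.
Proof.
rewrite /polyact -big_split; apply: eq_bigr => i _ /=; rewrite -scalerDr.
by congr (_ *: _); elim: (i : nat) => //= n ->; rewrite linearD.
Qed.

Lemma polyact0 g : polyact 0 g = 0.
Proof. exact: (linear0 (polyact_at g)). Qed.

Lemma polyactM p q g : polyact (p * q) g = polyact p (polyact q g).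
Proof.
rewrite mulrC; elim/poly_ind: q g => [|q c IH] g.
  by rewrite mul0r !polyact0 -[in RHS](scale0r g) polyact_argZ scale0r.
rewrite mulrDl !polyactD mulrAC (polyactMX (q * p)) IH polyactMX polyact_argD.
by rewrite mul_polyC polyactZ polyactC polyact_argZ.
Qed.

End PolyAction.

(** * Norms of polynomials in a contraction; powers against binomial mixtures *)

Section PolyActionNorm.
Variables (R : realType) (V : Type) (F : {linear bfun R V -> bfun R V}).
Local Notation pnorm_le p c := (norm_le (polyact F p) c).

Lemma pnorm_leD p c q e : pnorm_le p c -> pnorm_le q e -> pnorm_le (p + q) (c +
  e).
Proof.
move=> pc qe; apply: eq_norm_le (norm_leD pc qe) => g.
by rewrite polyactD.
Qed.

Lemma pnorm_leZ a p c : pnorm_le p c -> pnorm_le (a *: p) (`|a| * c).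
Proof.
by move=> pc; apply: eq_norm_le (norm_leZ a pc) => g; rewrite polyactZ.
Qed.

Lemma pnorm_leZ_ge0 a p c : 0 <= a -> pnorm_le p c -> pnorm_le (a *: p) (a * c).
Proof. by move=> a0 /(pnorm_leZ a); rewrite ger0_norm. Qed.

Lemma pnorm_leM p c q e : pnorm_le p c -> pnorm_le q e -> pnorm_le (p * q) (c *
  e).
Proof.
by move=> pc qe; apply: eq_norm_le (norm_le_comp pc qe) => g; rewrite polyactM.
Qed.

Lemma pnorm_le0 : pnorm_le 0 0.
Proof. by move=> g b gb y; rewrite polyact0 normr0 mul0r. Qed.

Lemma pnorm_le_sum n (p : 'I_n -> {poly R}) c :
  (forall i, pnorm_le (p i) c) -> pnorm_le (\sum_(i < n) p i) (n%:R * c).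
Proof.
elim: n p => [|n IH] p pc; first by rewrite big_ord0 mul0r; exact: pnorm_le0.
by rewrite big_ord_recr /= -natr1 mulrDl mul1r; apply: pnorm_leD => //; exact:
  IH.
Qed.

Lemma pnorm_le_binmean t m (p : nat -> {poly R}) (c : nat -> R^o) :
  0 <= t <= 1 -> (forall k, pnorm_le (p k) (c k)) ->
  pnorm_le (binmean t m p) (binmean t m c).
Proof.
move=> /andP[t0 t1]; elim: m p c => [|m IH] p c pc /=; first exact: pc.
apply: pnorm_leD; apply: pnorm_leZ_ge0; rewrite ?subr_ge0//; exact: IH.
Qed.

Hypothesis F1 : norm_le F 1.

Lemma pnorm_leXn k : pnorm_le 'X^k 1.
Proof.
by apply: eq_norm_le (norm_le_iter k F1) => g; rewrite polyactXn.
Qed.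

Lemma pnorm_le_sumXn r : pnorm_le (\sum_(i < r) 'X^i) r%:R.
Proof.
by rewrite -[r%:R]mulr1; apply: pnorm_le_sum => i; exact: pnorm_leXn.
Qed.

Lemma exprX_taylor k n : exists2 Q : {poly R},
  'X^k - 'X^n - (k%:R - n%:R) *: ('X^n * ('X - 1)) =
    'X^(minn k n) * ('X - 1) ^+ 2 * Q &
  pnorm_le Q ((k%:R - n%:R) ^+ 2).
Proof.
have [nk|kn] := leqP n k.
  set r := (k - n)%N; have -> : k = (n + r)%N by rewrite /r subnKC.
  (* Times ['X - 1], the inner sum becomes ['X^i - 1], and the outer sum is then geometric. *)
  exists (\sum_(i < r) \sum_(l < i) 'X^l).
    have -> : (n + r)%:R - n%:R = r%:R :> R by rewrite natrD addrC addKr.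
    have e1 : ('X - 1) * (\sum_(i < r) \sum_(l < i) 'X^l) =
        \sum_(i < r) 'X^i - r%:R :> {poly R}.
      rewrite mulr_sumr; under eq_bigr do rewrite -subrX1.
      by rewrite sumrB sumr_const card_ord.
    have e2 : 'X^r = ('X - 1) * (\sum_(i < r) 'X^i) + 1 :> {poly R}.
      by rewrite -subrX1 subrK.
    rewrite exprD expr2 !mulrA -[RHS]mulrA e1 scaler_nat -mulr_natl e2; ring.
  have -> : (n + r)%:R - n%:R = r%:R :> R by rewrite natrD addrC addKr.
  apply: pnorm_le_sum => i; apply: norm_le_weak (pnorm_le_sumXn _).
  by rewrite ler_nat ltnW.
set r := (n - k)%N; have -> : n = (k + r)%N by rewrite /r subnKC// ltnW.
have -> : k%:R - (k + r)%:R = - r%:R :> R by rewrite natrD opprD addNKr.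
(* Times ['X - 1], each summand telescopes to ['X^r - 'X^i]; this fixes the inner length [r - i]. *)
exists (\sum_(i < r) 'X^i * \sum_(l < r - i) 'X^l).
  have e1 : ('X - 1) * (\sum_(i < r) 'X^i * \sum_(l < r - i) 'X^l) =
      'X^r * r%:R - \sum_(i < r) 'X^i :> {poly R}.
    rewrite mulr_sumr.
    have e (i : 'I_r) : ('X - 1 : {poly R}) * ('X^i * \sum_(l < r - i) 'X^l) =
        'X^r - 'X^i.
      by rewrite mulrCA -subrX1 mulrBr mulr1 -exprD subnKC// ltnW.
    under eq_bigr do rewrite e.
    by rewrite sumrB sumr_const card_ord mulr_natr.
  have e2 : ('X - 1) * (\sum_(i < r) 'X^i) = 'X^r - 1 :> {poly R}.
    by rewrite -subrX1.
  have -> : 'X^k * ('X - 1) ^+ 2 * (\sum_(i < r) 'X^i * \sum_(l < r - i) 'X^l) =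
     'X^k * (('X - 1) * ('X^r * r%:R) - ('X - 1) * (\sum_(i < r) 'X^i)) :>
       {poly R}.
    by rewrite -mulrBr -e1; ring.
  by rewrite e2 scaleNr scaler_nat -mulr_natr exprD; ring.
rewrite sqrrN; apply: pnorm_le_sum => i.
rewrite -[r%:R]mul1r; apply: pnorm_leM; first exact: pnorm_leXn.
by apply: norm_le_weak (pnorm_le_sumXn _); rewrite ler_nat leq_subr.
Qed.

(** As [m * t = n] is the binomial mean, the first-order term of the expansion of ['X^k] at ['X^n]
    averages to zero, and only the second-order remainder is left. The constant is
    [32 = 4 * (7 + 1)]. *)
Lemma binomial_vs_power (n m : nat) (t D : R) :
  (0 < n)%N -> 0 < t <= 1 -> m%:R * t = n%:R -> 0 <= D ->
  (forall k, (k <= n)%N -> pnorm_le (('X - 1) * 'X^k) (D / k.+1%:R)) ->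
  pnorm_le ('X^n - (1 + t *: ('X - 1)) ^+ m) (32 * D ^+ 2 / n%:R).
Proof.
move=> n0 t01 mt D0 HD; have [t0 t1] := andP t01.
have t01' : 0 <= t <= 1 by rewrite (ltW t0).
have pow_mean : (1 + t *: ('X - 1)) ^+ m = binmean t m (fun k => 'X^k : {poly
  R}).
  rewrite -[LHS]mul1r -(expr0 ('X : {poly R})) -(binmean_exp t ('X : {poly R})).
  exact: eq_binmean.
(* One factor ['X - 1] goes with each half of ['X^k]; halving the power costs a factor [2] each
   time, hence the [4]. *)
have HD2 k : (k <= n)%N ->
    pnorm_le ('X^k * ('X - 1) ^+ 2) (4 * D ^+ 2 / (k.+1%:R * k.+2%:R)).
  move=> kn.
  have kn1 : (k./2 <= n)%N by lia.
  have kn2 : (k - k./2 <= n)%N by lia.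
  have -> : 'X^k * ('X - 1) ^+ 2 =
      (('X - 1) * 'X^(k./2)) * (('X - 1) * 'X^(k - k./2)) :> {poly R}.
    by rewrite -{1}(@subnKC k./2 k) ?exprD; [ring|lia].
  apply: norm_le_weak (pnorm_leM (HD _ kn1) (HD _ kn2)).
  have -> : 4 * D ^+ 2 / (k.+1%:R * k.+2%:R) =
      (2 * D / k.+1%:R) * (2 * D / k.+2%:R) :> R by rewrite invfM; ring.
  have aux a b : (0 < a)%N -> (0 < b <= 2 * a)%N -> D / a%:R <= 2 * D / b%:R.
    move=> a0 /andP[b0 ba]; rewrite ler_pdivrMr ?ltr0n// mulrAC.
    by rewrite ler_pdivlMr ?ltr0n// [2 * D]mulrC -mulrA ler_wpM2l// -natrM
      ler_nat.
  by apply: ler_pM; rewrite ?divr_ge0 ?ler0n// aux//; lia.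
set e := fun k => 'X^k - 'X^n - (k%:R - n%:R) *: ('X^n * ('X - 1)) : {poly R}.
have -> : 'X^n - (1 + t *: ('X - 1)) ^+ m = (-1) *: binmean t m e.
  rewrite pow_mean scaleN1r.
  rewrite (@eq_binmean _ t _ m e (fun k => 'X^k + ((- 'X^n) +
    (k%:R - n%:R : R^o) *: (- ('X^n * ('X - 1)))))); last first.
    by move=> k; rewrite scalerN [RHS]addrA.
  rewrite !binmeanD binmean_cst binmeanZl binmeanD binmean_id binmean_cst mt.
  by rewrite subrr scale0r addr0 opprD opprK addrC.
(* [c1] serves [k < n] and [c2] serves [n <= k], according to [minn k n]; their sum avoids a case
   split inside the mean. *)
set c1 := fun k => (k%:R - n%:R) ^+ 2 / (k.+1%:R * k.+2%:R) : R^o.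
set c2 := fun k => (k%:R - n%:R) ^+ 2 / (n.+1%:R * n.+2%:R) : R^o.
have c10 k : 0 <= c1 k by rewrite divr_ge0 ?sqr_ge0 ?mulr_ge0 ?ler0n.
have c20 k : 0 <= c2 k by rewrite divr_ge0 ?sqr_ge0 ?mulr_ge0 ?ler0n.
have D20 : 0 <= 4 * D ^+ 2 by rewrite mulr_ge0 ?sqr_ge0 ?ler0n.
have He k : pnorm_le (e k) ((c1 k + c2 k) * (4 * D ^+ 2)).
  have [Q eQ Qb] := exprX_taylor k n; rewrite /e eQ.
  apply: norm_le_weak (pnorm_leM (HD2 _ (geq_minr _ _)) Qb).
  rewrite mulrAC -mulrA mulrC; apply: ler_wpM2r => //.
  have [_|_] := leqP n k; first by rewrite lerDr.
  by rewrite lerDl.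
apply: norm_le_weak (pnorm_leZ (-1) (pnorm_le_binmean m t01' He)).
rewrite normrN1 mul1r binmeanM binmeanD.
have -> : 32 * D ^+ 2 / n%:R = (8 / n%:R) * (4 * D ^+ 2) by ring.
apply: ler_wpM2r => //.
(* The [7] bounds the mean of [c1]; the [1] bounds that of [c2], a variance of at most [n] divided
   by [n.+1 * n.+2]. *)
have -> : 8 / n%:R = 7 / n%:R + 1 / n%:R :> R by ring.
apply: lerD; first exact: binmean_inv2_sqr_dist.
rewrite (binmeanM t m (fun k => (k%:R - n%:R) ^+ 2 : R^o)) binmean_sqr_dist mt.
rewrite subrr expr0n addr0 ler_pdivrMr ?mulr_gt0 ?ltr0n// mulrAC ler_pdivlMr
  ?ltr0n//.
rewrite mul1r; apply: (@le_trans _ _ (n%:R * n%:R)); last first.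
  by rewrite -!natrM ler_nat; lia.
by rewrite ler_wpM2r ?ler0n// ler_piMr ?ler0n//; lra.
Qed.

End PolyActionNorm.

(** * Smoothing by lazy random walks *)

Section BinomialSecondDifference.
Variable R : realFieldType.

Lemma coef_exp1DX_ge0 k i : 0 <= ((1 + 'X : {poly R}) ^+ k)`_i.
Proof.
elim: k i => [|k IH] i; first by rewrite expr0 coef1 ler0n.
rewrite exprSr mulrDr mulr1 coefD coefMX.
by case: eqP => _; rewrite ?addr0// addr_ge0.
Qed.

Lemma coef_derivMX (p : {poly R}) i : (p^`() * 'X)`_i = i%:R * p`_i.
Proof. by rewrite coefMX; case: i => [|i]; rewrite ?mul0r// coef_deriv
  mulr_natl. Qed.

(** By [1 - 'X = (1 + 'X) - 2 'X], the product combines [Q = (1 + 'X)^(N+2)] with its first two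
    derivatives times ['X] and ['X^2]; differentiating and multiplying by ['X] scales coefficient
    [i] by [i]. The last factor is twice a quadratic Krawtchouk polynomial. *)
Lemma coef_binomial_diff2 N i :
  N.+1%:R * N.+2%:R * ((1 + 'X) ^+ N * (1 - 'X) ^+ 2 : {poly R})`_i =
  ((1 + 'X : {poly R}) ^+ N.+2)`_i * ((N.+2%:R - 2 * i%:R) ^+ 2 - N.+2%:R).
Proof.
set Q := (1 + 'X : {poly R}) ^+ N.+2.
have Q1 : Q^`() = N.+2%:R *: (1 + 'X) ^+ N.+1.
  by rewrite /Q deriv_exp derivD derivX derivC add0r mul1r scaler_nat.
have Q2 : Q^`()^`() = (N.+1%:R * N.+2%:R) *: (1 + 'X) ^+ N.
  rewrite Q1 derivZ deriv_exp derivD derivX derivC add0r mul1r.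
  by rewrite -[_ *+ N.+1]scaler_nat scalerA mulrC.
have e : (N.+1%:R * N.+2%:R) *: ((1 + 'X) ^+ N * (1 - 'X) ^+ 2) =
    (N.+1%:R * N.+2%:R) *: Q - (4 * N.+1%:R) *: (Q^`() * 'X) +
    4 *: (Q^`()^`() * 'X * 'X).
  rewrite Q2 Q1 /Q !exprS -!mul_polyC !polyCM !polyC_natr.
  by move: ((1 + 'X) ^+ N : {poly R}) (N.+1%:R : {poly R}) (N.+2%:R : {poly R})
    ('X : {poly R}) => P a b x; ring.
rewrite -coefZ e.
have -> : Q^`()^`() * 'X * 'X = (Q^`() * 'X)^`() * 'X - Q^`() * 'X.
  by rewrite derivM derivX mulr1 mulrDl addrK.
rewrite !(coefD, coefN, coefZ, coef_derivMX) -/Q.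
by move: (Q`_i) => u; rewrite -[N.+2%:R]natr1; ring.
Qed.

Lemma size_exp_le2 (q : {poly R}) k :
  (size q <= 2)%N -> (size (q ^+ k)%R <= k.+1)%N.
Proof. by move=> q2; rewrite (leq_trans (size_poly_exp_leq _ _))// ltnS; nia.
  Qed.

Lemma size_1DX : (size (1 + 'X : {poly R})%R <= 2)%N.
Proof. by rewrite (leq_trans (size_polyD _ _))// size_poly1 size_polyX. Qed.

Lemma size_binomial_diff2 N :
  (size ((1 + 'X) ^+ N * (1 - 'X) ^+ 2 : {poly R})%R <= N.+3)%N.
Proof.
have sz1B : (size (1 - 'X : {poly R})%R <= 2)%N.
  by rewrite (leq_trans (size_polyD _ _))// size_polyN size_poly1 size_polyX.
rewrite (leq_trans (size_polyMleq _ _))// -subn1 leq_subLR.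
apply: leq_trans (leq_add (size_exp_le2 N size_1DX) (size_exp_le2 2 sz1B)) _.
by rewrite !addnS addn0.
Qed.

(** With [u = N.+2 - 2 i], one has [|u^2 - N.+2| <= (u^2 - N.+2) + 2 N.+2]. The first part sums to
    [p.[1] = 0], the second to a multiple of [Q.[1] = 4 * 2 ^+ N]. *)
Lemma l1_binomial_diff2 N :
  \sum_(i < N.+3) `|((1 + 'X) ^+ N * (1 - 'X) ^+ 2 : {poly R})`_i| <=
  8 * 2 ^+ N / N.+1%:R.
Proof.
set p := ((1 + 'X) ^+ N * (1 - 'X) ^+ 2 : {poly R}).
set Q := (1 + 'X : {poly R}) ^+ N.+2.
have szp : (size p <= N.+3)%N := size_binomial_diff2 N.
have k0 : 0 < N.+1%:R * N.+2%:R :> R by rewrite mulr_gt0 ?ltr0n.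
rewrite -(ler_pM2l k0) mulr_sumr.
have -> : N.+1%:R * N.+2%:R * (8 * 2 ^+ N / N.+1%:R) =
    \sum_(i < N.+3) (N.+1%:R * N.+2%:R * p`_i + 2 * N.+2%:R * Q`_i) :> R.
  rewrite big_split /= -!mulr_sumr.
  have -> : \sum_(i < N.+3) p`_i = p.[1].
    by rewrite (horner_coef_wide _ szp); apply: eq_bigr => i _; rewrite expr1n
      mulr1.
  have -> : \sum_(i < N.+3) Q`_i = Q.[1].
    rewrite (horner_coef_wide _ (size_exp_le2 _ size_1DX)).
    by apply: eq_bigr => i _; rewrite expr1n mulr1.
  have -> : p.[1] = 0 by rewrite /p expr2 !hornerM hornerD hornerN hornerX
    hornerC subrr !mulr0.
  have -> : Q.[1] = 2 ^+ N * 4 by rewrite horner_exp hornerD hornerX hornerC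
    -[1 + 1]/2 !exprSr; ring.
  by rewrite mulr0 add0r; field; rewrite nat1r pnatr_eq0.
apply: ler_sum => i _; rewrite -{1}(gtr0_norm k0) -normrM.
rewrite coef_binomial_diff2 normrM ger0_norm ?coef_exp1DX_ge0// -/Q.
rewrite [2 * _ * _]mulrC -mulrDr ler_wpM2l ?coef_exp1DX_ge0//.
rewrite (le_trans (ler_normB _ _))// ger0_norm ?sqr_ge0// ger0_norm ?ler0n//.
by rewrite le_eqVlt; apply/orP; left; apply/eqP; ring.
Qed.

End BinomialSecondDifference.

Lemma pnorm_le_l1 (R : realType) (V : Type) (T : {linear bfun R V -> bfun R V})
    (p : {poly R}) n :
  norm_le T 1 -> (size p <= n)%N ->
  norm_le (polyact T p) (\sum_(i < n) `|p`_i|).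
Proof.
move=> T1 pn g b gb; rewrite (polyact_widen T g pn).
elim/big_rec2: _ => [|i s c _ IH]; first by move=> y; rewrite normr0 mul0r.
rewrite mulrDl; apply: bounded_byD => //; apply: bounded_byZ.
by rewrite -[b]mul1r; exact: (norm_le_iter i T1).
Qed.

Lemma iter_linear (R : pzRingType) (B : lmodType R) (T : {linear B -> B}) k a u
  v :
  iter k T (a *: u + v) = a *: iter k T u + iter k T v.
Proof. by elim: k => //= k ->; rewrite linearP. Qed.

(** * Translations, second differences and lazy walks *)

Section Translation.
Variables (R : realType) (V : zmodType).
Implicit Types (x y : V) (g : bfun R V).

Fact translate_subproof x g : (fun y => g (y + x)) \in @bounded_pred R V.
Proof. by have [c gc] := bounded_byP g; apply: (mk_bounded (c := c)) => y. Qed.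

Definition translate x g : bfun R V := BFun (translate_subproof x g).

Lemma translateE x g y : translate x g y = g (y + x).
Proof. by []. Qed.

Let bfunE := (translateE, bfunDE, bfunZE, bfunNE).

Fact translate_is_linear x : linear (translate x).
Proof. by move=> a g h; apply: bfunP. Qed.

HB.instance Definition _ x :=
  GRing.isLinear.Build R (bfun R V) (bfun R V) _ (translate x)
  (translate_is_linear x).

Lemma norm_le_translate x : norm_le (translate x) 1.
Proof. by move=> g b gb y; rewrite mul1r; apply: gb. Qed.

Lemma translateD x y g : translate x (translate y g) = translate (x + y) g.
Proof. by apply: bfunP => z /=; rewrite addrA. Qed.

Lemma translate0 g : translate 0 g = g.
Proof. by apply: bfunP => z /=; rewrite addr0. Qed.

Definition sym_diff x g : bfun R V :=
  translate x g + translate (- x) g - 2 *: g.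

Definition lazy_walk x g : bfun R V :=
  2^-1 *: g + 4^-1 *: (translate x g + translate (- x) g).

Fact sym_diff_is_linear x : linear (sym_diff x).
Proof.
move=> a g h; apply: bfunP => y.
by rewrite /sym_diff !bfunE; ring.
Qed.

HB.instance Definition _ x :=
  GRing.isLinear.Build R (bfun R V) (bfun R V) _ (sym_diff x)
  (sym_diff_is_linear x).

Fact lazy_walk_is_linear x : linear (lazy_walk x).
Proof.
move=> a g h; apply: bfunP => y.
by rewrite /lazy_walk !bfunE; ring.
Qed.

HB.instance Definition _ x :=
  GRing.isLinear.Build R (bfun R V) (bfun R V) _ (lazy_walk x)
  (lazy_walk_is_linear x).

(* [sym_diff x = E^-1 (1 - E)^2] and [lazy_walk x = E^-1 (1 + E)^2 / 4], where
   [E = translate x]. *)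
Lemma sym_diff_poly x g :
  sym_diff x g = translate (- x) (polyact (translate x) ((1 - 'X) ^+ 2) g).
Proof.
have -> : (1 - 'X : {poly R}) ^+ 2 = 'X * 'X - 2 *: 'X + 1.
  by rewrite -mul_polyC; ring.
rewrite !polyactD polyactN polyactZ polyactM !polyactX polyact1.
apply: bfunP => y; rewrite /sym_diff !bfunE.
by rewrite subrK; ring.
Qed.

Lemma lazy_walk_poly x g : lazy_walk x g =
  translate (- x) (polyact (translate x) (4^-1 *: (1 + 'X) ^+ 2) g).
Proof.
have -> : (1 + 'X : {poly R}) ^+ 2 = 'X * 'X + 2 *: 'X + 1.
  by rewrite -mul_polyC; ring.
rewrite polyactZ !polyactD polyactZ polyactM !polyactX polyact1.
apply: bfunP => y; rewrite /sym_diff !bfunE.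
by rewrite subrK; field.
Qed.

Lemma polyact_translateC x y p g :
  polyact (translate x) p (translate y g) = translate y (polyact (translate x)
    p g).
Proof.
rewrite /polyact linear_sum; apply: eq_bigr => i _; rewrite linearZZ.
by congr (_ *: _); elim: (i : nat) => //= n ->; rewrite !translateD addrC.
Qed.

(** The composite is a power of [translate (- x)] times a polynomial in [translate x], the scaled
    binomial second difference with [N = 2 * j]; the l1 norm of its coefficients bounds its norm. *)
Lemma norm_le_sym_diff_lazy_walk x j :
  norm_le (fun g => sym_diff x (iter j (lazy_walk x) g)) (8 / j.+1%:R).
Proof.
set E := translate x.
have iterE k p g : polyact E p (iter k (translate (- x)) g) =
    iter k (translate (- x)) (polyact E p g).
  by elim: k => //= k <-; exact: polyact_translateC.
have lw g : iter j (lazy_walk x) g =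
    iter j (translate (- x)) (polyact E (4^-1 ^+ j *: (1 + 'X) ^+ (2 * j)) g).
  elim: j => [|j IH]; first by rewrite muln0 !expr0 scale1r polyact1.
  rewrite iterS IH lazy_walk_poly iterS; congr translate.
  set q := 4^-1 *: _; set r := 4^-1 ^+ j *: _.
  have -> : 4^-1 ^+ j.+1 *: (1 + 'X) ^+ (2 * j.+1) = q * r :> {poly R}.
    by rewrite /q /r -scalerAl -scalerAr scalerA -exprS -exprD mulnS.
  by rewrite polyactM iterE.
pose p : {poly R} := 4^-1 ^+ j *: ((1 + 'X) ^+ (2 * j) * (1 - 'X) ^+ 2).
have szp : (size p <= (2 * j).+3)%N.
  exact: leq_trans (size_scale_leq _ _) (size_binomial_diff2 _ _).
apply: (@eq_norm_le _ _ (iter j.+1 (translate (- x)) \o polyact E p)).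
  move=> g; rewrite lw sym_diff_poly iterE -polyactM /p -scalerAr.
  by rewrite [(1 - 'X) ^+ 2 * _]mulrC.
(* The denominator [2 * j + 1] is relaxed to [j + 1], to fit the inverse moment in
   [binmean_inv_le]. *)
apply: (@norm_le_weak _ _ _ (1 * (8 / (2 * j).+1%:R))).
  by rewrite mul1r ler_wpM2l// lef_pV2 ?posrE ?ltr0n// ler_nat; lia.
apply: norm_le_comp; first exact/norm_le_iter/norm_le_translate.
apply: norm_le_weak (pnorm_le_l1 (@norm_le_translate x) szp).
have c0 : 0 < 4^-1 ^+ j :> R by rewrite exprn_gt0// invr_gt0.
have -> : 8 / (2 * j).+1%:R =
    4^-1 ^+ j * (8 * 2 ^+ (2 * j) / (2 * j).+1%:R) :> R.
  have -> : 2 ^+ (2 * j) = 4 ^+ j :> R by rewrite exprM expr2 -natrM.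
  by rewrite exprVn [8 * 4 ^+ j]mulrC !mulrA mulVf ?mul1r// expf_neq0
    ?pnatr_eq0.
under eq_bigr do rewrite coefZ normrM (gtr0_norm c0).
by rewrite -mulr_sumr ler_pM2l//; exact: l1_binomial_diff2.
Qed.

Section Smoothing.
Variables (F : {linear bfun R V -> bfun R V}) (x : V) (a : R).
Hypothesis a01 : 0 < a <= 1.
Hypothesis FE : forall y g, F (translate y g) = translate y (F g).
Hypothesis Fa : norm_le (fun g => F g - a *: lazy_walk x g) (1 - a).

(** Each factor [F] is split into [a] times the lazy walk plus a remainder of norm [1 - a]. Lazy
    walks commute with [F] by translation invariance, so their number is binomial and the bound is
    the mean of [8 / (i + 1)]. *)
Lemma norm_le_sym_diff_iter k :
  norm_le (fun g => sym_diff x (iter k F g)) (8 / (a * k.+1%:R)).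
Proof.
have Flazy g : F (lazy_walk x g) = lazy_walk x (F g).
  by rewrite /lazy_walk linearD !linearZZ linearD !FE.
have iterFlazy i g : iter i F (lazy_walk x g) = lazy_walk x (iter i F g).
  by elim: i => //= i ->.
have [a0 a1] := andP a01.
(* [j] counts the lazy walks already extracted; it is general because each extraction raises it. *)
have main j : norm_le (fun g => sym_diff x (iter j (lazy_walk x) (iter k F g)))
    (binmean a k (fun i => 8 / (i + j).+1%:R : R^o)).
  elim: k j => [|k IH] j; first exact: norm_le_sym_diff_lazy_walk.
  set U := fun g => sym_diff x (iter j (lazy_walk x) (iter k F g)).
  have U_lin b u v : U (b *: u + v) = b *: U u + U v.
    by rewrite /U !iter_linear linearP.
  have := norm_leD (norm_leZ a (IH j.+1)) (norm_le_comp (IH j) Fa).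
  rewrite gtr0_norm//.
  set L := (fun g => _ : bfun R V) => HL.
  apply: (@eq_norm_le _ _ L).
    move=> g.
    transitivity (a *: U (lazy_walk x g) + U (F g - a *: lazy_walk x g)).
      by rewrite /L /U iterFlazy -iterSr.
    by rewrite -U_lin addrC subrK /U -iterSr.
  apply: norm_le_weak HL; rewrite addrC mulrC le_eqVlt; apply/orP; left.
  apply/eqP; congr (_ + _ * _); apply: eq_binmean => i.
  by rewrite addSnnS.
have := main 0%N; rewrite /=; apply: norm_le_weak.
rewrite (@eq_binmean _ a _ _ _ (fun i => i.+1%:R^-1 * 8 : R^o)); last first.
  by move=> i; rewrite addn0 mulrC.
rewrite binmeanM mulrC ler_wpM2l//.
by rewrite mulrC; apply: binmean_inv_le.
Qed.

End Smoothing.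
End Translation.

Local Open Scope classical_set_scope.

(** * The exponential as a limit of powers *)

Section ExponentialLimit.
Variable R : realType.

(** The ratio of ['C(m, j) / m^j] to [1 / j!] is a product of factors [1 - i / m] with [i < j],
    whose losses add up to at most [j (j - 1) / m]. *)
Lemma ffact_ratio_ge (m j : nat) : (0 < m)%N ->
  let r : R := (m ^_ j)%:R / m%:R ^+ j in
  1 - (j * j.-1)%:R / m%:R <= r <= 1.
Proof.
move=> m0; have m0' : 0 < m%:R :> R by rewrite ltr0n.
elim: j => [|j IH] /=; first by rewrite ffactn0 mul0n mul0r subr0 divr1 lexx.
have [mj|jm] := leqP m j.
  have -> : m ^_ j.+1 = 0%N by apply: ffact_small.
  rewrite mul0r ler01 andbT subr_le0 ler_pdivlMr// mul1r ler_nat /=; nia.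
have -> : (m ^_ j.+1)%:R / m%:R ^+ j.+1 =
    (m ^_ j)%:R / m%:R ^+ j * (1 - j%:R / m%:R) :> R.
  rewrite ffactnSr natrM natrB ?(ltnW jm)// exprSr.
  by field; rewrite expf_neq0 gt_eqF.
case/andP: IH => IH1 IH2.
have jm' : 0 <= (j%:R / m%:R : R) <= 1.
  by rewrite divr_ge0 ?ler0n//= ler_pdivrMr// mul1r ler_nat ltnW.
set x := (m ^_ j)%:R / m%:R ^+ j in IH1 IH2 *.
have x0 : 0 <= x by rewrite divr_ge0 ?ler0n ?exprn_ge0.
apply/andP; split; last by apply: mulr_ile1 => //; lra.
have -> : (j.+1 * j)%:R = (j * j.-1)%:R + 2 * j%:R :> R.
  by rewrite -natrM -natrD; congr _%:R => /=; case: (j) => //=; lia.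
rewrite mulrDl; nra.
Qed.

(** Since [j (j - 1) / j! = 1 / (j - 2)!], the termwise errors sum to at most [c ^+ 2 / m] times a
    partial exponential series. *)
Lemma exp_series_vs_power (a : nat -> R) (c : R) (m : nat) : (0 < m)%N ->
  (forall j, `|a j| <= c ^+ j) -> 0 <= c ->
  `|\sum_(j < m.+1) (j`!%:R)^-1 * a j -
    \sum_(j < m.+1) 'C(m, j)%:R / m%:R ^+ j * a j| <= c ^+ 2 * expR c / m%:R.
Proof.
move=> m0 ac c0; have m0' : 0 < m%:R :> R by rewrite ltr0n.
rewrite -sumrB; apply: le_trans (ler_norm_sum _ _ _) _.
have term (j : nat) : `|(j`!%:R)^-1 * a j - 'C(m, j)%:R / m%:R ^+ j * a j| <=
    (j * j.-1)%:R / m%:R * (c ^+ j / j`!%:R).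
  have f0 : j`!%:R != 0 :> R by rewrite pnatr_eq0 -lt0n fact_gt0.
  have -> : (j`!%:R)^-1 * a j - 'C(m, j)%:R / m%:R ^+ j * a j =
      (1 - (m ^_ j)%:R / m%:R ^+ j) * (a j / j`!%:R) :> R.
    by rewrite -bin_ffact natrM mulrBl mul1r; congr (_ - _); [ring|field;
      rewrite f0 expf_neq0// gt_eqF].
  have /andP[h1 h2] := ffact_ratio_ge j m0.
  rewrite normrM ger0_norm ?subr_ge0//; apply: ler_pM; rewrite ?subr_ge0//;
    first lra.
  by rewrite normrM normfV (ger0_norm (ler0n _ _)) ler_wpM2r// invr_ge0 ler0n.
apply: le_trans (ler_sum _ (fun (j : 'I_m.+1) _ => term j)) _.
rewrite ler_pdivlMr// mulr_suml.
(* The terms of index [0] and [1] vanish, which shifts the index by two. *)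
have -> : \sum_(i < m.+1) ((i * i.-1)%:R / m%:R * (c ^+ i / i`!%:R) * m%:R) =
    \sum_(i < m.-1) c ^+ 2 * (c ^+ i / i`!%:R).
  case: m m0 m0' term => // m _ m0' _.
  rewrite -(big_mkord xpredT (fun i : nat =>
    (i * i.-1)%:R / m.+1%:R * (c ^+ i / i`!%:R) * m.+1%:R)).
  rewrite 2?big_nat_recl// big_mkord !mul0r !add0r; apply: eq_bigr => i _.
  rewrite [_.-1]/= !factS !natrM !exprS.
  have i0 : i`!%:R != 0 :> R by rewrite pnatr_eq0 -lt0n fact_gt0.
  by field; rewrite i0 !nat1r -natrD !pnatr_eq0.
rewrite -mulr_sumr ler_wpM2l ?exprn_ge0// -(big_mkord xpredT (exp_coeff c)).
apply: (nondecreasing_cvgn_le _ (is_cvg_series_exp_coeff c)).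
by apply: nondecreasing_series => i _ _; exact: exp_coeff_ge0.
Qed.

(** [K] is uniform in [m], so it survives the limit. Convergence is recorded too, as it is needed to
    move the limit into the extended reals. *)
Lemma exp_series_limit (a : nat -> R) (c x K : R) (n : nat) : 0 <= c ->
  (forall j, `|a j| <= c ^+ j) ->
  (forall m, (n < m)%N ->
    `|x - \sum_(j < m.+1) 'C(m, j)%:R / m%:R ^+ j * a j| <= K) ->
  cvgn (series (fun j => (j`!%:R)^-1 * a j)) /\
  `|x - limn (series (fun j => (j`!%:R)^-1 * a j))| <= K.
Proof.
move=> c0 ac xK; set u := series _.
have cu : cvgn u.
  apply: normed_cvg; apply: series_le_cvg (is_cvg_series_exp_coeff c) => j.
  - exact: normr_ge0.
  - exact: exp_coeff_ge0.
  - by rewrite /exp_coeff /= normrM mulrC normfV (ger0_norm (ler0n _ _))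
    ler_wpM2r ?invr_ge0 ?ler0n.
split=> //; apply/ler_addgt0Pr => e e0.
have e2 : 0 < e / 2 by rewrite divr_gt0.
have cuS : (fun m => u m.+1) @ \oo --> limn u by rewrite cvg_shiftS.
near \oo => m.
have nm : (n < m)%N by near: m; exact: nbhs_infty_gt.
have m0 : (0 < m)%N by apply: leq_ltn_trans nm.
have h1 : `|limn u - u m.+1| <= e / 2.
  by near: m; move/cvgrPdist_le : cuS; exact.
have h2 : c ^+ 2 * expR c / (e / 2) <= m%:R by near: m; exact: nbhs_infty_ger.
have h3 := exp_series_vs_power m0 ac c0.
have h4 : c ^+ 2 * expR c / m%:R <= e / 2.
  by rewrite ler_pdivrMr ?ltr0n// [leRHS]mulrC -ler_pdivrMr.
have h5 := xK _ nm.
have -> : x - limn u =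
    (x - \sum_(j < m.+1) 'C(m, j)%:R / m%:R ^+ j * a j) +
    ((u m.+1 - limn u) - (u m.+1 - \sum_(j < m.+1) 'C(m, j)%:R / m%:R ^+ j * a
      j)).
  by ring.
apply: le_trans (ler_normD _ _) _; apply: lerD => //.
apply: le_trans (ler_normB _ _) _; rewrite distrC.
have -> : u m.+1 = \sum_(j < m.+1) (j`!%:R)^-1 * a j by rewrite /u /series /=
  big_mkord.
have -> : e = e / 2 + e / 2 by field.
apply: lerD; last exact: le_trans h3 h4.
by move: h1; rewrite /u /series /= big_mkord.
Unshelve. all: by end_near. Qed.

End ExponentialLimit.

(** * Measures carried by a countable set *)

Section CountableSupport.
Local Open Scope ereal_scope.
Context (disp : measure_display) (T : measurableType disp) (R : realType).
Variable L : set T.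
Hypothesis countL : countable L.
Hypothesis mset1 : forall x : T, L x -> measurable [set x].

(** An injection into [nat] cuts the set into countably many fibres, each empty or a singleton. *)
Lemma countable_subset_measurable (A : set T) : A `<=` L -> measurable A.
Proof.
move=> AL; have [f finj] := elimT (countable_injP L) countL.
have -> : A = \bigcup_k (A `&` f @^-1` [set k]).
  by apply/seteqP; split => [x Ax|x [k _ []]//]; exists (f x).
apply: bigcup_measurable => k _.
have [->|/set0P[x [Ax fx]]] := eqVneq (A `&` f @^-1` [set k]) set0.
  exact: measurable0.
suff -> : A `&` f @^-1` [set k] = [set x] by apply: mset1; apply: AL.
apply/seteqP; split => [y [Ay fy]|y ->] //.
by apply: finj; rewrite ?inE; [exact: AL|exact: AL|rewrite fx fy].
Qed.

Lemma measurableL : measurable L.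
Proof. exact: countable_subset_measurable. Qed.

Lemma measurable_fun_countable d' (U : measurableType d') (f : T -> U) :
  measurable_fun L f.
Proof. by move=> _ Y mY; apply: countable_subset_measurable => x []. Qed.

Import HBNNSimple.

Variable mu : {measure set T -> \bar R}.
Hypothesis muL : mu (~` L) = 0.

(* A simple function below [f] has the same integral as its restriction to [L],
   so [f] may be arbitrary. *)
Lemma integral_restrict_countable (f : T -> \bar R) :
  \int[mu]_x f x = \int[mu]_(x in L) f x.
Proof.
suff ge0 (g : T -> \bar R) : (forall x, 0 <= g x) ->
    \int[mu]_x g x = \int[mu]_(x in L) g x.
  rewrite integralE [in RHS]integralE; congr (_ - _); exact: ge0.
move=> g0; have mgL : measurable_fun setT (g \_ L : T -> \bar R).
  apply/measurable_restrict; [exact: measurableL|exact: measurableT|].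
  by rewrite setTI; exact: measurable_fun_countable.
have gL0 x : 0 <= (g \_ L) x by rewrite patchE; case: ifP.
rewrite [RHS]integral_mkcond; apply/eqP; rewrite eq_le; apply/andP; split; last
  first.
  rewrite !ge0_integralTE//; apply: ereal_sup_le => _ [h hg <-]; exists h => //
    x; apply: le_trans (hg x) _.
  by rewrite patchE; case: ifP => // _; exact: g0.
rewrite ge0_integralTE//; apply: ge_ereal_sup => _ [h hg <-].
rewrite -integralT_nnsfun (@ge0_negligible_integral _ _ _ _ _ (~` L)) //; last
  3 first.
- by apply: measurableC; exact: measurableL.
- exact/measurable_EFinP.
- by move=> x _; rewrite lee_fin.
rewrite setTD setCK integral_mkcond; apply: ge0_le_integral => //.
- by move=> x _; rewrite patchE; case: ifP => // _; rewrite lee_fin.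
- apply/measurable_restrict; [exact: measurableL|exact: measurableT|].
  by rewrite setTI; exact: measurable_fun_countable.
- by move=> x _; rewrite !patchE; case: ifP.
Qed.

Lemma integral_countable_esum (f : T -> R) : (forall x, (0 <= f x)%R) ->
  \int[mu]_x (f x)%:E = \esum_(x in L) ((f x)%:E * mu [set x]).
Proof.
move=> f0; rewrite integral_restrict_countable.
have [e einj] := elimT (countable_injP L) countL.
pose A k := L `&` e @^-1` [set k].
have LA : L = \bigcup_k A k.
  by apply/seteqP; split => [x Lx|x [k _ []]//]; exists (e x).
have tA : trivIset setT A.
  by apply/trivIsetP => i j _ _ ij; rewrite -subset0 => x [[_ /= exi] [_ /=
    exj]];
    move: ij; rewrite -exi -exj eqxx.
have mA k : measurable (A k) by apply: countable_subset_measurable => x [].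
have mf : measurable_fun (\bigcup_k A k) (EFin \o f).
  by rewrite -LA; exact: measurable_fun_countable.
rewrite [in LHS]LA ge0_integral_bigcup//=; last by move=> x _; rewrite lee_fin.
rewrite [in RHS]LA nneseries_sum_bigcup//; last first.
  by move=> x; rewrite mule_ge0 ?lee_fin.
apply: eq_eseriesr => k _.
have [->|/set0P[x [Lx ex]]] := eqVneq (A k) set0.
  by rewrite integral_set0 esum_set0.
have -> : A k = [set x].
  apply/seteqP; split => [y [Ly ey]|y ->] //.
  by apply: einj; rewrite ?inE// ex ey.
rewrite esum_set1; last by rewrite mule_ge0 ?lee_fin.
rewrite (eq_integral (cst (f x)%:E)); last by move=> y; rewrite inE => ->.
by rewrite integral_cst//; exact: mset1.
Qed.

End CountableSupport.

(** * Integrals of bounded functions against charges on a countable set *)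

Section BoundedIntegral.
Local Open Scope ereal_scope.
Context (disp : measure_display) (T : measurableType disp) (R : realType).
Variable L : set T.
Hypothesis countL : countable L.
Hypothesis mset1 : forall x : T, L x -> measurable [set x].

Lemma bounded_integrable_countable (m : {finite_measure set T -> \bar R})
    (f : T -> R) c :
  (forall x, `|f x| <= c)%R -> m.-integrable L (EFin \o f).
Proof.
move=> fc; apply: measurable_bounded_integrable.
- exact: measurableL.
- by rewrite -ge0_fin_numE// fin_num_measure//; exact: measurableL.
- exact: measurable_fun_countable.
- exists c; split; first by rewrite num_real.
  by move=> M cM x _; apply: le_trans (fc x) (ltW cM).
Qed.

(** Any splitting of [M] may replace the Jordan one: equal differences mean [jp + m2 = jn + m1] as
    positive measures, whose integrals of nonnegative functions agree; adding the constant [c]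
    reaches bounded [f]. *)
Lemma charge_integral_countable (M : {charge set T -> \bar R})
    (m1 m2 : {finite_measure set T -> \bar R}) (f : T -> R) c :
  m1 (~` L) = 0 -> m2 (~` L) = 0 ->
  (forall A, measurable A -> M A = m1 A - m2 A) ->
  (forall x, `|f x| <= c)%R ->
  charge_integral M (EFin \o f) =
    (\int[m1]_(x in L) f x - \int[m2]_(x in L) f x)%R%:E.
Proof.
move=> m1L m2L Mm fc0.
have {c fc0} [c c0 fc] : exists2 c : R, (0 <= c)%R & forall x, (`|f x| <= c)%R.
  by exists `|c|%R => // x; apply: le_trans (fc0 x) (ler_norm c).
rewrite /charge_integral.
have mL := measurableL countL mset1.
case: cid => P hP; case: cid => N hPN.
have [[mP _] [mN _] _ _] := hPN.
have mCL : measurable (~` L) by exact: measurableC.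
have null (m : {finite_measure set T -> \bar R}) A : m (~` L) = 0 ->
    measurable A -> m (~` L `&` A) = 0.
  move=> mL0 mA; apply/eqP; rewrite eq_le measure_ge0 andbT -mL0.
  by apply: le_measure; rewrite ?inE//; exact: measurableI.
have jpL : jordan_pos hPN (~` L) = 0.
  rewrite jordan_posE cjordan_posE /crestr0 mem_set// /crestr Mm; last exact:
    measurableI.
  by rewrite !null// sube0.
have jnL : jordan_neg hPN (~` L) = 0.
  rewrite jordan_negE cjordan_negE /crestr0 mem_set// /crestr Mm; last exact:
    measurableI.
  by rewrite !null// sube0 oppe0.
rewrite (integral_restrict_countable countL mset1 jpL).
rewrite (integral_restrict_countable countL mset1 jnL).
pose jp : {finite_measure set T -> \bar R} := jordan_pos hPN.
pose jn : {finite_measure set T -> \bar R} := jordan_neg hPN.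
change (\int[jp]_(x in L) (EFin \o f) x - \int[jn]_(x in L) (EFin \o f) x =
  (\int[m1]_(x in L) f x - \int[m2]_(x in L) f x)%R%:E).
have add A : measurable A -> measure_add jp m2 A = measure_add jn m1 A.
  move=> mA; suff : jp A + m2 A = jn A + m1 A by rewrite !measure_addE.
  have : m1 A - m2 A = jp A - jn A.
    by rewrite -Mm// (jordan_decomp hPN mA) /cadd /= cscaleN1.
  have : jp A \is a fin_num by rewrite fin_num_measure.
  have : jn A \is a fin_num by rewrite fin_num_measure.
  have : m1 A \is a fin_num by rewrite fin_num_measure.
  have : m2 A \is a fin_num by rewrite fin_num_measure.
  move: (jp A) (jn A) (m1 A) (m2 A) => [a||] [b||] [a'||] [b'||] // _ _ _ _ [e].
  by congr EFin; lra.
have addR (g : T -> R) e : (forall x, 0 <= g x <= e)%R ->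
    (\int[jp]_(x in L) g x + \int[m2]_(x in L) g x =
     \int[jn]_(x in L) g x + \int[m1]_(x in L) g x)%R.
  move=> ge; have g0 x : (0 <= g x)%R by case/andP: (ge x).
  have gle x : (`|g x| <= e)%R by rewrite ger0_norm//; case/andP: (ge x).
  have fin (m : {finite_measure set T -> \bar R}) :
      \int[m]_(x in L) (g x)%:E \is a fin_num.
    by apply: integrable_fin_num => //; exact: bounded_integrable_countable gle.
  rewrite /Rintegral -!fineD; try exact: fin.
  congr fine.
  have mg : measurable_fun L (EFin \o g) by exact: measurable_fun_countable.
  rewrite -!ge0_integral_measure_add//; do ?by move=> x _; rewrite lee_fin.
  by apply: eq_measure_integral => A mA _; exact: add.
have shift (m : {finite_measure set T -> \bar R}) :
    (\int[m]_(x in L) (f x + c) = \int[m]_(x in L) f x + \int[m]_(x in L) c)%R.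
  apply: RintegralD => //; first exact: bounded_integrable_countable fc.
  by apply: (@bounded_integrable_countable m (cst c) c) => x; rewrite /=
    ger0_norm.
have fin (m : {finite_measure set T -> \bar R}) :
    \int[m]_(x in L) (f x)%:E = (\int[m]_(x in L) f x)%R%:E.
  rewrite /Rintegral fineK//.
  by apply: integrable_fin_num => //; exact: bounded_integrable_countable fc.
rewrite !fin -EFinB; congr EFin.
have Ec : (\int[jp]_(x in L) c + \int[m2]_(x in L) c =
           \int[jn]_(x in L) c + \int[m1]_(x in L) c)%R.
  by apply: (addR (cst c) c) => x; rewrite /= c0 lexx.
have : (\int[jp]_(x in L) (f x + c) + \int[m2]_(x in L) (f x + c) =
        \int[jn]_(x in L) (f x + c) + \int[m1]_(x in L) (f x + c))%R.
  apply: (addR (fun x => f x + c)%R (c + c)%R) => x.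
  by have := fc x; rewrite ler_norml => /andP[f1 f2]; apply/andP; split; lra.
rewrite !shift; lra.
Qed.

End BoundedIntegral.

(** * Borel sets, the lattice and supports in Euclidean space *)

Section BorelRd.
Local Open Scope ereal_scope.
Variables (R : realType) (d : nat).
Local Notation V := ('rV[R]_d).

Lemma open_measurable_Rd (U : set V) : open U -> measurable (U : set (Rd R d)).
Proof. by move=> oU; exact: sub_sigma_algebra. Qed.

Lemma measurable_set1_Rd (x : V) : measurable ([set x] : set (Rd R d)).
Proof.
rewrite -[X in measurable X]setCK; apply: measurableC.
apply: open_measurable_Rd; rewrite openC.
by apply: accessible_closed_set1; apply: hausdorff_accessible; exact:
  norm_hausdorff.
Qed.

Lemma countable_lattice : countable (@lattice R d).
Proof.
apply: (@sub_countable _ _ _ ((fun z : 'rV[int]_d => map_mx intr z : V) @`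
  setT)).
  apply: subset_card_le => x Lx.
  exists (map_mx Num.floor x) => //; apply/rowP => i; rewrite !mxE.
  by apply/eqP; rewrite -intrEfloor; exact: Lx.
exact: (sub_countable (card_image_le _ _) (countableP _)).
Qed.

Lemma lattice0 : @lattice R d (0%R : V).
Proof. by move=> i; rewrite mxE. Qed.

Lemma latticeN (x : V) : lattice x -> lattice (- x)%R.
Proof. by move=> Lx i; rewrite mxE rpredN; exact: Lx. Qed.

Lemma rational_ball_basis (U : set V) (x : V) : open U -> U x ->
  exists (r : 'rV[rat]_d) (k : nat),
    ball (map_mx ratr r : V) k.+1%:R^-1 x /\
    ball (map_mx ratr r : V) k.+1%:R^-1 `<=` U.
Proof.
move=> oU Ux; have /nbhs_ballP[e /= e0 eU] := open_nbhs_nbhs (conj oU Ux).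
(* A radius below [e / 2] leaves room for the triangle inequality through the rational centre. *)
have [k ke] : exists k : nat, (2 * k.+1%:R^-1 < e :> R)%R.
  have e2 : (0 < e / 2)%R by rewrite divr_gt0.
  by have [k ke] := ltr_add_invr e2; exists k; move: ke; rewrite add0r
    ltr_pdivlMr// mulrC.
have k0 : (0 < k.+1%:R^-1 :> R)%R by rewrite invr_gt0 ltr0n.
have [r rx] : exists r : 'rV[rat]_d, ball (map_mx ratr r : V) k.+1%:R^-1 x.
  have /choice[f fP] : forall i : 'I_d, exists q : rat,
      (`|ratr q - x ord0 i| < k.+1%:R^-1)%R.
    move=> i; have : (x ord0 i - k.+1%:R^-1 < x ord0 i + k.+1%:R^-1)%R.
      by rewrite ltrBlDr -addrA ltrDl addr_gt0.
    by move=> /rat_in_itvoo[q]; rewrite in_itv /= => qx; exists q; rewrite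
      ltr_distl.
  exists (\row_i f i); split=> // i j; rewrite !ord1 /ball /= !mxE; exact: fP.
exists r, k; split=> // y ry; apply: eU; apply: le_ball (ltW ke) _ _.
rewrite mulr_natl mulr2n; apply: ball_triangle ry; exact: ball_sym.
Qed.

(* Lindelof: the complement of the support is covered by countably many null
   rational balls. *)
Lemma supp_full_measure (mu : {measure set (Rd R d) -> \bar R}) (A : set (Rd R
  d)) :
  measurable A -> supp mu `<=` A -> mu (~` A) = 0.
Proof.
move=> mA sA; apply: measure_negligible; first exact: measurableC.
pose B (p : 'rV[rat]_d * nat) : set V := ball (map_mx ratr p.1 : V)
  p.2.+1%:R^-1.
pose C (n : nat) : set (Rd R d) :=
  if unpickle n is Some p then if mu (B p) == 0 then B p else set0 else set0.
have nC n : mu.-negligible (C n).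
  rewrite /C; case: unpickle => [p|]; last exact: negligible_set0.
  case: eqP => [p0|_]; last exact: negligible_set0.
  apply/negligibleP => //; apply: open_measurable_Rd; exact: ball_open.
apply: negligibleS (negligible_bigcup nC) => x nAx.
have : ~ supp mu x by move=> /sA.
move=> /existsNP[U /not_implyP[oU /not_implyP[Ux /negP]]].
rewrite -leNgt => U0; have [r [k [rx rU]]] := rational_ball_basis oU Ux.
exists (pickle (r, k)) => //; rewrite /C pickleK /=.
suff -> : mu (B (r, k)) == 0 by [].
rewrite eq_le measure_ge0 andbT; apply: le_trans U0.
by apply: le_measure; rewrite ?inE//; apply: open_measurable_Rd => //; exact:
  ball_open.
Qed.

Lemma supp_atom (mu : {measure set (Rd R d) -> \bar R}) (x : V) :
  0 < mu [set x] -> supp mu x.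
Proof.
move=> x0 U oU Ux; apply: lt_le_trans x0 _; apply: le_measure; rewrite ?inE//.
- exact: measurable_set1_Rd.
- exact: open_measurable_Rd.
- by move=> _ ->.
Qed.

End BorelRd.

(** * The averaging operator of a symmetric lattice distribution *)

Section LatticeExpectation.
Variables (R : realType) (d : nat) (F : probability (Rd R d) R).
Hypothesis suppF : supp F `<=` @lattice R d.
Local Notation V := ('rV[R]_d).
Local Notation L := (@lattice R d).

Let countL : countable L := countable_lattice R d.
Let mset1 (x : Rd R d) : L x -> measurable [set x].
Proof. by move=> _; exact: measurable_set1_Rd. Qed.
Let mL : measurable L := measurableL countL mset1.
Let FL : F (~` L) = 0%E := supp_full_measure mL suppF.

Definition mass (x : V) : R := fine (F [set x]).

Lemma massE x : F [set x] = (mass x)%:E.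
Proof. by rewrite /mass fineK// fin_num_measure//; exact: measurable_set1_Rd.
  Qed.

Lemma mass_ge0 x : 0 <= mass x.
Proof. exact: fine_ge0. Qed.

(** Integration is confined to the lattice, where every function is measurable, so boundedness alone
    gives integrability. *)
Definition expect (f : V -> R) : R := \int[F]_(x in L) f x.

Lemma expect_integrable (f : V -> R) (c : R) : (forall x, `|f x| <= c) ->
  F.-integrable L (EFin \o f).
Proof. exact: (bounded_integrable_countable countL mset1). Qed.

Lemma expectD (f g : V -> R) (cf cg : R) :
  (forall x, `|f x| <= cf) -> (forall x, `|g x| <= cg) ->
  expect (fun x => f x + g x) = expect f + expect g.
Proof.
move=> fc gc; apply: RintegralD => //.
- exact: expect_integrable fc.
- exact: expect_integrable gc.
Qed.

Lemma expectP (a : R) (f g : V -> R) (cf cg : R) :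
  (forall x, `|f x| <= cf) -> (forall x, `|g x| <= cg) ->
  expect (fun x => a * f x + g x) = a * expect f + expect g.
Proof.
move=> fc gc; rewrite (@expectD (fun x => a * f x) g (`|a| * cf) cg)//; last
  first.
  by move=> x; rewrite normrM ler_wpM2l.
by rewrite /expect RintegralZl//; exact: expect_integrable fc.
Qed.

Lemma expect_cst c : expect (fun=> c) = c.
Proof.
have FL1 : F L = 1%E.
  rewrite -(@probability_setT _ _ _ F) -(setUv L) measureU ?setICr//.
    exact: (esym (etrans (congr1 (fun z => F L + z)%E FL) (adde0 _))).
  exact: measurableC.
transitivity (c * fine (F L)); first exact: Rintegral_cst.
by rewrite FL1 mulr1.
Qed.

Lemma le_expect (f g : V -> R) (cf cg : R) :
  (forall x, `|f x| <= cf) -> (forall x, `|g x| <= cg) ->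
  (forall x, f x <= g x) -> expect f <= expect g.
Proof.
move=> fc gc fg; apply: le_Rintegral => //.
- exact: expect_integrable fc.
- exact: expect_integrable gc.
Qed.

Lemma expect_norm_le (f : V -> R) (c : R) : (forall x, `|f x| <= c) -> `|expect
  f| <= c.
Proof.
move=> fc; have c0 : 0 <= c by rewrite (le_trans _ (fc 0)).
rewrite ler_norml; apply/andP; split.
  rewrite -[leLHS]expect_cst; apply: (@le_expect _ _ c c) => // x.
    by rewrite normrN ger0_norm.
  by have := fc x; rewrite ler_norml => /andP[].
rewrite -[leRHS]expect_cst; apply: (@le_expect _ _ c c) => // x.
  by rewrite ger0_norm.
by have := fc x; rewrite ler_norml => /andP[].
Qed.

Lemma expect_esum (f : V -> R) (c : R) : (forall x, 0 <= f x <= c) ->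
  (expect f)%:E = \esum_(x in L) (f x * mass x)%:E.
Proof.
move=> fc; have f0 x : 0 <= f x by case/andP: (fc x).
have fa x : `|f x| <= c by rewrite ger0_norm//; case/andP: (fc x).
rewrite /expect /Rintegral fineK; last first.
  by apply: integrable_fin_num => //; exact: expect_integrable fa.
rewrite -(integral_restrict_countable countL mset1 FL).
rewrite (integral_countable_esum countL mset1 FL f0).
by apply: eq_esum => x _; rewrite EFinM; congr (_ * _)%E; exact: massE.
Qed.

Hypothesis symF : symmetric_on_lattice F.

Lemma massN x : L x -> mass (- x) = mass x.
Proof. by move=> Lx; rewrite /mass -symF. Qed.

(** Expectations become sums over lattice points, reindexed by negation; those sums need nonnegative
    terms, so [f] is first shifted by [c]. *)
Lemma expect_opp (f : V -> R) (c : R) : (forall x, `|f x| <= c) ->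
  expect (fun x => f (- x)) = expect f.
Proof.
move=> fc; have c0 : 0 <= c by rewrite (le_trans _ (fc 0)).
have shift (g : V -> R) : (forall x, `|g x| <= c) -> expect (fun x => g x + c)
  = expect g + c.
  move=> gc; rewrite (@expectD _ (fun=> c) c c) ?expect_cst// => x.
  by rewrite ger0_norm.
have fcN x : `|f (- x)| <= c by [].
have b (g : V -> R) (x : V) : (forall x, `|g x| <= c) -> 0 <= g x + c <= c + c.
  by move=> /(_ x); rewrite ler_norml => /andP[h1 h2]; apply/andP; split; lra.
apply: (@addIr _ c); rewrite -!shift//; apply: EFin_inj.
rewrite (expect_esum (fun x => b (fun x => f (- x)) x fcN)).
rewrite (expect_esum (fun x => b f x fc)).
rewrite (@reindex_esum _ _ _ L L -%R); last first.
  split.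
  - by move=> x Lx; exact: latticeN.
  - by move=> x y _ _; exact: oppr_inj.
  - by move=> x Lx; exists (- x); [exact: latticeN|rewrite opprK].
by apply: eq_esum => x Lx; rewrite massN// opprK.
Qed.

(** Only the distinct atoms [0], [x] and [- x] are kept: [F] dominates [q I + p_x (E_x + E_{-x})],
    tested on nonnegative functions. *)
Lemma expect_ge_atoms (g : V -> R) (c : R) (x : V) : (forall y, 0 <= g y <= c)
  ->
  L x -> x != 0 ->
  mass 0 * g 0 + mass x * (g x + g (- x)) <= expect g.
Proof.
move=> gc Lx x0.
have c0 : 0 <= c by case/andP: (gc 0) => h1 h2; exact: le_trans h2.
have gb y : `|g y| <= c by rewrite ger0_norm//; case/andP: (gc y).
have ind (y : V) : L y -> expect (fun z => (z == y)%:R) = mass y.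
  move=> Ly; rewrite /expect /Rintegral /mass.
  rewrite (eq_integral (fun z : Rd R d => (\1_[set y] z : R)%:E)); last first.
    by move=> z _; rewrite indicE in_set1.
  rewrite integral_indic//; last exact: mset1.
  by congr (fine (F _)); apply/seteqP; split=> [z []//|z ->].
have indb (y z : V) : `|(z == y)%:R : R| <= 1 by case: eqP; rewrite ?normr1
  ?normr0.
have xNx : x != - x.
  apply: contra_neq x0 => /rowP xNx; apply/rowP => i; have := xNx i.
  by rewrite !mxE => ?; lra.
(* The minorant is nested and ends in [0], so that [expectP] peels off one atom at a time; [b3],
   [b2] and [b1] are the bounds it requires. *)
have b3 z : `|g (- x) * (z == - x)%:R + 0| <= c.
  by rewrite addr0 normrM -[c]mulr1; apply: ler_pM.
have b2 z : `|g x * (z == x)%:R + (g (- x) * (z == - x)%:R + 0)| <= c + c.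
  by rewrite (le_trans (ler_normD _ _))// lerD// normrM -[c]mulr1; apply:
    ler_pM.
have b1 z : `|g 0 * (z == 0)%:R + (g x * (z == x)%:R + (g (- x) * (z == - x)%:R
  + 0))|
    <= c + (c + c).
  by rewrite (le_trans (ler_normD _ _))// lerD// normrM -[c]mulr1; apply:
    ler_pM.
have zb (z : V) : `|0 : R| <= 0 by rewrite normr0.
apply: le_trans (le_expect b1 gb _).
  rewrite (expectP _ (indb 0) b2) (expectP _ (indb x) b3).
  rewrite (expectP _ (indb (- x)) zb) expect_cst !ind//; last 2 first.
  - exact: latticeN.
  - exact: lattice0.
  by rewrite massN// addr0 -mulrDl [mass 0 * _]mulrC [mass x * _]mulrC.
move=> z; have g0 y : 0 <= g y by case/andP: (gc y).
have [->|z0] := eqVneq z 0; last first.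
  have [->|zx] := eqVneq z x; first by rewrite (negbTE xNx) mulr0 mulr1 mulr0
    !addr0 add0r.
  have [->|zNx] := eqVneq z (- x); first by rewrite !mulr0 mulr1 !add0r addr0.
  by rewrite !mulr0 !add0r.
rewrite mulr1 ![0 == _]eq_sym (negbTE x0) oppr_eq0 (negbTE x0) !mulr0 !addr0//.
Qed.

Fact avg_subproof (g : bfun R V) :
  (fun y => expect (fun z => g (y + z))) \in @bounded_pred R V.
Proof.
have [c gc] := bounded_byP g.
by apply: (mk_bounded (c := c)) => y; apply: expect_norm_le => z; exact: gc.
Qed.

Definition avg (g : bfun R V) : bfun R V := BFun (avg_subproof g).

Lemma avgE g y : avg g y = expect (fun z => g (y + z)).
Proof. by []. Qed.

Fact avg_is_linear : linear avg.
Proof.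
move=> a g h; apply: bfunP => y.
have [c gc] := bounded_byP g; have [e he] := bounded_byP h.
by rewrite bfunDE bfunZE !avgE -(@expectP _ _ _ c e).
Qed.

HB.instance Definition _ := GRing.isLinear.Build R (bfun R V) (bfun R V) _ avg
  avg_is_linear.

Lemma norm_le_avg : norm_le avg 1.
Proof.
by move=> g b gb y; rewrite mul1r avgE; apply: expect_norm_le => z; exact: gb.
Qed.

Lemma avg_translate x g : avg (translate x g) = translate x (avg g).
Proof.
apply: bfunP => y; rewrite translateE !avgE; congr expect; apply/funext => z.
by rewrite translateE addrAC.
Qed.

End LatticeExpectation.

Lemma esum_mule_le (R : realType) (T : choiceType) (I : set T) (c : R)
    (a : T -> \bar R) : 0 <= c -> (forall i, 0 <= a i)%E ->
  (\esum_(i in I) (c%:E * a i) <= c%:E * \esum_(i in I) a i)%E.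
Proof.
move=> c0 a0; apply: ge_ereal_sup => _ [X [finX XI] <-].
rewrite -ge0_mule_fsumr//; apply: lee_wpmul2l; first by rewrite lee_fin.
by apply: esum_ge; exists X.
Qed.

(** * Smoothing by a symmetric lattice distribution *)

Section Smoothing.
Variables (R : realType) (d : nat) (F : probability (Rd R d) R).
Hypothesis suppF : supp F `<=` @lattice R d.
Hypothesis symF : symmetric_on_lattice F.
Local Notation V := ('rV[R]_d).
Local Notation L := (@lattice R d).
Local Notation T := (avg suppF).
Local Notation q := (mass F 0).
Hypothesis q01 : 0 < q < 1.

Lemma mass_pair_le (x : V) : L x -> x != 0 -> q + 2 * mass F x <= 1.
Proof.
move=> Lx x0.
have := @expect_ge_atoms _ _ _ suppF symF (fun=> 1) 1 x.
by rewrite expect_cst// mulr1 => le1; rewrite mulrC; apply: le1 => // _;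
  rewrite ler01 lexx.
Qed.

Lemma expectN (f : V -> R) (c : R) : (forall x, `|f x| <= c) ->
  expect F (fun x => - f x) = - expect F f.
Proof.
move=> fc; have -> : (fun x => - f x) = (fun x => -1 * f x + 0).
  by apply/funext => x; rewrite mulN1r addr0.
rewrite (@expectP _ _ F _ _ (fun=> 0) c 0)// ?expect_cst//.
  by rewrite mulN1r addr0.
by move=> x; rewrite normr0.
Qed.

(** Here [a / 2 <= q] and [a / 4 <= p_x], so the difference is a positive operator of mass [1 - a].
    Testing it on [b - f], with [f] a shift of [g] or of [- g], gives the two sides of the norm
    bound. *)
Lemma norm_le_avg_sub_lazy (x : V) : L x -> x != 0 ->
  let a := 4 * q * mass F x in
  norm_le (fun g => T g - a *: lazy_walk x g) (1 - a).
Proof.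
move=> Lx x0 a g b gb y; rewrite bfunDE bfunNE bfunZE avgE.
rewrite /lazy_walk !(bfunDE, bfunZE, translateE).
have [q0 q1] := andP q01.
have p0 := mass_ge0 F x; have qp := mass_pair_le Lx x0.
have key (f : V -> R) : (forall z, `|f z| <= b) ->
    expect F f - a * (2^-1 * f 0 + 4^-1 * (f x + f (- x))) <= (1 - a) * b.
  move=> fb; have b0 : 0 <= b by rewrite (le_trans _ (fb 0)).
  have bf z : 0 <= b - f z <= b + b.
    by have := fb z; rewrite ler_norml => /andP[h1 h2]; apply/andP; split; lra.
  have := expect_ge_atoms suppF symF bf Lx x0.
  have -> : expect F (fun z => b - f z) = b - expect F f.
    have -> : (fun z => b - f z) = (fun z => -1 * f z + b).
      by apply/funext => z; rewrite mulN1r addrC.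
    rewrite (@expectP _ _ F _ _ (fun=> b) b b)// ?expect_cst//.
      by rewrite mulN1r addrC.
    by move=> z; rewrite ger0_norm.
  have /andP[h0 _] := bf 0; have /andP[hx _] := bf x; have /andP[hNx _] := bf
    (- x).
  have qa : 0 <= q - 2^-1 * a by rewrite /a; nra.
  have pa : 0 <= mass F x - 4^-1 * a by rewrite /a; nra.
  have := mulr_ge0 qa h0; have := mulr_ge0 pa hx; have := mulr_ge0 pa hNx.
  move: (expect F f) (mass F x) (f 0) (f x) (f (- x)) a {qa pa h0 hx hNx qp p0}
    => *.
  lra.
have fb (z : V) : `|g (y + z)| <= b by exact: gb.
have fNb (z : V) : `|- g (y + z)| <= b by rewrite normrN.
have := key _ fNb; have := key _ fb; rewrite (expectN fb) addr0.
by move=> h1 h2; rewrite ler_norml; apply/andP; split; lra.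
Qed.

Lemma norm_le_sym_diff_avg (x : V) k : L x -> x != 0 -> 0 < mass F x ->
  norm_le (fun g => sym_diff x (iter k T g))
    (2 / (q * mass F x * k.+1%:R)).
Proof.
move=> Lx x0 p0; have [q0 q1] := andP q01.
have qp := mass_pair_le Lx x0.
have a01 : 0 < 4 * q * mass F x <= 1.
  by rewrite !mulr_gt0//=; nra.
have := norm_le_sym_diff_iter a01 (avg_translate suppF) (norm_le_avg_sub_lazy
  Lx x0) k.
apply: norm_le_weak; rewrite le_eqVlt; apply/orP; left; apply/eqP.
by field; rewrite nat1r pnatr_eq0 /= !gt_eqF.
Qed.

Lemma norm_le_sym_diff4 (x : V) : norm_le (@sym_diff R V x) 4.
Proof.
move=> g b gb y; rewrite /sym_diff !(bfunDE, bfunZE, bfunNE, translateE).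
have := gb (y + x); have := gb (y - x); have := gb y.
by rewrite !ler_norml => /andP[? ?] /andP[? ?] /andP[? ?]; apply/andP; split;
  lra.
Qed.

(** By symmetry, averaging over [z] equals averaging over [z] and [- z] together, which produces
    half a second difference. *)
Lemma avg_sub_id (h : bfun R V) y :
  T h y - h y = expect F (fun z => 2^-1 * sym_diff z h y).
Proof.
have [c hc] := bounded_byP h.
have hyc (z : V) : `|h (y + z)| <= c by exact: hc.
have hyNc (z : V) : `|h (y - z)| <= c by exact: hc.
have -> : (fun z => 2^-1 * sym_diff z h y) =
    (fun z => 2^-1 * h (y + z) + (2^-1 * h (y - z) + - h y)).
  apply/funext => z; rewrite /sym_diff !(bfunDE, bfunZE, bfunNE, translateE).
  by field.
rewrite (@expectP _ _ F _ _ (fun z => 2^-1 * h (y - z) + - h y) c (c + c))//.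
  rewrite (@expectP _ _ F _ _ (fun=> - h y) c c)// ?expect_cst//; last first.
    by move=> _; rewrite normrN.
  rewrite (@expect_opp _ _ F suppF symF (fun z => h (y + z)) c)// avgE.
  by field.
move=> z; rewrite (le_trans (ler_normD _ _))// lerD// ?normrN// normrM
  ger0_norm//.
by have := hyNc z; have := normr_ge0 (h (y - z)); lra.
Qed.

(** The norm is at most a sum over atoms [z] of [p_z] times half a second difference. Each summand
    is bounded twice, by smoothing and trivially, matching the two entries of the minimum in
    [delta]. *)
Lemma norm_le_avg_sub1 (n : nat) (delta1 : R) k : (0 < n)%N -> (k <= n)%N ->
  delta F n%:R = delta1%:E ->
  norm_le (polyact T (('X - 1) * 'X^k)) (delta1 / q / k.+1%:R).
Proof.
move=> n0 kn d1; have [q0 q1] := andP q01.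
apply: (@eq_norm_le _ _ (fun g => T (iter k T g) - iter k T g)).
  by move=> g; rewrite polyactM polyactD polyactN polyactX polyact1 polyactXn.
move=> g b gb y; rewrite bfunDE bfunNE avg_sub_id.
have b0 : 0 <= b by rewrite (le_trans _ (gb y)).
set h := iter k T g; set f := fun z => 2^-1 * _.
have hb : bounded_by h b.
  by rewrite -[b]mul1r; exact: norm_le_iter (norm_le_avg suppF) _ _ gb.
have fb (z : V) : `|f z| <= 2 * b.
  have := norm_le_sym_diff4 z hb y; rewrite /f normrM ger0_norm//; lra.
have f0 : f 0 = 0.
  by rewrite /f /sym_diff oppr0 !translate0 !(bfunDE, bfunZE, bfunNE); ring.
pose kap := (q * k.+1%:R)^-1 * b.
have k0 : 0 < k.+1%:R :> R by rewrite ltr0n.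
have kap0 : 0 <= kap by rewrite mulr_ge0// invr_ge0 mulr_ge0// ltW.
have fa : forall z, 0 <= `|f z| <= 2 * b by move=> z; rewrite normr_ge0 fb.
have fmass z : z \in supp F `\ (0 : V) ->
    `|f z| * mass F z <= kap * Num.min 1 (4 * n%:R * mass F z).
  rewrite inE => -[Sz /eqP z0]; have Lz := suppF Sz.
  have [->|p0] := eqVneq (mass F z) 0.
    by rewrite !mulr0 mulr_ge0// le_min lexx ler01.
  have {}p0 : 0 < mass F z by rewrite lt_neqAle eq_sym p0 mass_ge0.
  rewrite minr_pMr// mulr1 le_min; apply/andP; split.
    (* Smoothing gives the entry [1]: the mass of [z] cancels the one in the denominator. *)
    have := norm_le_sym_diff_avg k Lz z0 p0 gb y.
    rewrite -/h => fz; have -> : kap = 2^-1 * (2 / (q * mass F z * k.+1%:R) *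
      b) * mass F z.
      by rewrite /kap; field; rewrite nat1r pnatr_eq0 !gt_eqF.
    by rewrite ler_wpM2r ?mass_ge0// /f normrM ger0_norm// ler_wpM2l.
  (* The trivial bound [2 * b] gives the other entry, by [q * k.+1 <= k.+1 <= 2 * n], which relies
     on [k <= n]. *)
  rewrite mulrA ler_wpM2r ?mass_ge0//; apply: le_trans (fb z) _.
  have qk : 0 < q * k.+1%:R by rewrite mulr_gt0.
  have K2n : k.+1%:R <= 2 * n%:R :> R by rewrite -natrM ler_nat; lia.
  have qK : q * k.+1%:R <= k.+1%:R by rewrite ler_piMl ?ltW.
  rewrite -(ler_pM2l qk).
  have -> : q * k.+1%:R * (kap * (4 * n%:R)) = 4 * n%:R * b.
    by rewrite /kap; field; rewrite nat1r pnatr_eq0 (gt_eqF q0).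
  by rewrite mulrA ler_wpM2r//; lra.
have -> : delta1 / q / k.+1%:R * b = kap * delta1.
  by rewrite /kap; field; rewrite (gt_eqF q0) nat1r pnatr_eq0.
apply: (@le_trans _ _ (expect F (fun z => `|f z|))).
  apply: le_normr_Rintegral; last exact: expect_integrable fb.
  exact: measurableL (countable_lattice R d) (fun x _ => measurable_set1_Rd x).
rewrite -lee_fin (expect_esum suppF fa) EFinM -d1.
have a0 z : (0 <= (Num.min 1 (4 * n%:R * mass F z))%:E)%E.
  by rewrite lee_fin le_min ler01 !mulr_ge0 ?fine_ge0.
apply: le_trans (esum_mule_le _ kap0 a0).
(* A lattice point outside the range of [delta] is the origin, where the second difference vanishes,
   or has mass zero. *)
rewrite esum_mkcond [leRHS]esum_mkcond; apply: le_esum => z _.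
case: ifPn => [zL|_]; case: ifPn => [zS|zS] //.
- by rewrite -EFinM lee_fin; exact: fmass.
- rewrite lee_fin; have [->|z0] := eqVneq z (0 : V); first by rewrite f0 normr0
  mul0r.
  have [->|p0] := eqVneq (mass F z) 0; first by rewrite mulr0.
  exfalso; move/negP: zS; apply; rewrite inE; split; last exact/eqP.
  apply: supp_atom; rewrite [ltRHS](_ : _ = (mass F z)%:E); last exact: massE.
  by rewrite lte_fin lt_neqAle eq_sym p0 mass_ge0.
- by rewrite -EFinM lee_fin (le_trans _ (fmass _ zS))// mulr_ge0 ?mass_ge0.
Qed.

End Smoothing.

(** * Convolution powers and the exponential *)

Lemma Rintegral_mscale (disp : measure_display) (T : measurableType disp)
    (R : realType) (k : {nonneg R}) (m : {measure set T -> \bar R}) (D : set T)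
    (f : T -> R) : measurable D -> m.-integrable D (EFin \o f) ->
  \int[mscale k m]_(x in D) f x = k%:num * \int[m]_(x in D) f x.
Proof.
move=> mD intf; have mf := measurable_int _ intf.
have -> : k%:num = fine k%:num%:E by [].
rewrite /Rintegral -fineM//; last exact: integrable_fin_num.
congr fine; rewrite integralE [in RHS]integralE.
rewrite !ge0_integral_mscale//; [|exact: measurable_funeneg|exact:
  measurable_funepos].
rewrite [RHS]muleBr//; apply: fin_num_adde_defr.
exact: integrable_pos_fin_num.
Qed.

Section Bridge.
Variables (R : realType) (d : nat) (F : probability (Rd R d) R).
Hypothesis suppF : supp F `<=` @lattice R d.
Local Notation V := ('rV[R]_d).
Local Notation L := (@lattice R d).
Local Notation T := (avg suppF).

(** Covers both [F], with [c = 1] and [e = 0], and [n (F - I)], with [c = e = n]. *)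
Lemma charge_integral_avg (M : {charge set (Rd R d) -> \bar R})
    (c e : {nonneg R}) (g : bfun R V) :
  (forall A, measurable A ->
    M A = c%:num%:E * F A - e%:num%:E * @unit_mass R d A)%E ->
  charge_integral M (fun y : V => (g y)%:E) = (c%:num * T g 0 - e%:num * g
    0)%:E.
Proof.
move=> Mce; have [b gb] := bounded_byP g.
pose countL := countable_lattice R d.
pose mset1 := fun (x : Rd R d) (_ : L x) => measurable_set1_Rd (x : V).
pose mL : measurable L := measurableL countL mset1.
have FL : F (~` L) = 0%E := supp_full_measure mL suppF.
have dL : @unit_mass R d (~` L) = 0%E.
  rewrite /unit_mass /= diracE memNset//; apply; exact: lattice0.
have mF : mscale c F (~` L) = 0%E.
  by rewrite /mscale; transitivity (c%:num%:E * 0)%E; [congr (_ * _)%E|rewrite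
    mule0].
have md : mscale e (@unit_mass R d) (~` L) = 0%E.
  by rewrite /mscale; transitivity (e%:num%:E * 0)%E; [congr (_ * _)%E|rewrite
    mule0].
rewrite (charge_integral_countable countL mset1 mF md Mce gb).
congr EFin; rewrite !Rintegral_mscale//; last 2 first.
- exact: (bounded_integrable_countable countL mset1 (@unit_mass R d) gb).
- exact: (bounded_integrable_countable countL mset1 F gb).
congr (_ * _ - _ * _).
  by rewrite avgE /expect; under [RHS]eq_Rintegral do rewrite add0r.
rewrite /Rintegral integral_dirac//; last exact: measurable_fun_countable.
by rewrite diracE mem_set ?mul1e//; exact: lattice0.
Qed.

Definition indicator_bfun (B : set V) : bfun R V.
Proof.
refine (BFun (mk_bounded (f := \1_B) (c := 1) _)) => y.
by rewrite indicE; case: (_ \in _); rewrite ?normr1 ?normr0.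
Defined.

Lemma indicator_bfunE (B : set V) y : indicator_bfun B y = \1_B y.
Proof. by []. Qed.

Lemma bounded_by_indicator (B : set V) : bounded_by (indicator_bfun B) 1.
Proof.
by move=> y; rewrite indicator_bfunE indicE; case: (_ \in _); rewrite ?normr1
  ?normr0.
Qed.

Lemma polyact_avg_translate x p g :
  polyact T p (translate x g) = translate x (polyact T p g).
Proof.
rewrite /polyact linear_sum; apply: eq_bigr => i _; rewrite linearZZ.
by congr (_ *: _); elim: (i : nat) => //= n ->; rewrite avg_translate.
Qed.

(** The indicator of a shifted set is a translate of the indicator of [B], and translations commute
    with [p(T)]; so the integrand at [y] is the previous power, applied to the indicator and
    evaluated at [y]. *)
Lemma conv_pow_polyact (M : {charge set (Rd R d) -> \bar R}) (p : {poly R}) :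
  (forall g : bfun R V,
    charge_integral M (fun y : V => (g y)%:E) = (polyact T p g 0)%:E) ->
  forall j (B : set V),
    conv_pow M j B = (polyact T (p ^+ j) (indicator_bfun B) 0)%:E.
Proof.
move=> Mp; elim=> [|j IH] B.
  by rewrite expr0 polyact1 indicator_bfunE indicE /= /unit_mass /= diracE.
rewrite exprS polyactM -Mp /= /convolve; congr (charge_integral M).
apply/funext => y; rewrite IH.
have -> : indicator_bfun [set x | B (x + y)] = translate y (indicator_bfun B).
  apply: bfunP => x; rewrite translateE !indicator_bfunE !indicE.
  suff -> : (x \in [set x | B (x + y)]) = (x + y \in B) by [].
  by apply/idP/idP; rewrite !inE.
by rewrite polyact_avg_translate translateE add0r.
Qed.

Lemma conv_pow_F j (B : set V) :
  conv_pow (charge_of_finite_measure F) j B =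
    (polyact T 'X^j (indicator_bfun B) 0)%:E.
Proof.
apply: conv_pow_polyact => g.
rewrite (@charge_integral_avg _ 1%:nng 0%:nng)/=.
  by rewrite mul1r mul0r subr0 polyactX.
by move=> A mA; rewrite /= mul1e mul0r oppr0 adde0.
Qed.

Lemma conv_pow_exponent (n : nat) j (B : set V) :
  conv_pow (accompanying_exponent F n) j B =
    (polyact T ((n%:R *: ('X - 1)) ^+ j) (indicator_bfun B) 0)%:E.
Proof.
apply: conv_pow_polyact => g.
rewrite (@charge_integral_avg _ n%:R%:nng n%:R%:nng)/=.
  by rewrite polyactZ polyactD polyactN polyactX polyact1 !bfunZE bfunDE bfunNE
    mulrBr.
move=> A mA; rewrite /accompanying_exponent /= /cscale /cadd /copp /=.
by rewrite muleDr ?muleN// fin_num_adde_defr// fin_num_measure.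
Qed.

Lemma norm_le_exponent (n : nat) j :
  norm_le (polyact T ((n%:R *: ('X - 1)) ^+ j)) ((2 * n%:R) ^+ j).
Proof.
elim: j => [|j IH]; first by move=> g b gb; rewrite expr0 polyact1 mul1r.
rewrite !exprS; apply: pnorm_leM => //.
rewrite mulrC; apply: pnorm_leZ_ge0; first exact: ler0n.
rewrite -[X in norm_le _ X]/(1 + 1); apply: pnorm_leD.
  by apply: eq_norm_le (norm_le_avg suppF) => g; rewrite polyactX.
by move=> g b gb y; rewrite polyactN polyact1 bfunNE normrN mul1r; exact: gb.
Qed.

Lemma conv_exp_bound (n : nat) (K : R) (B : set V) :
  (forall m (t : R), 0 < t <= 1 -> m%:R * t = n%:R ->
     norm_le (polyact T ('X^n - (1 + t *: ('X - 1)) ^+ m)) K) -> (0 < n)%N ->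
  (`| conv_pow (charge_of_finite_measure F) n B -
      conv_exp (accompanying_exponent F n) B| <= K%:E)%E.
Proof.
move=> HK n0; have n0' : 0 < n%:R :> R by rewrite ltr0n.
pose a j := polyact T ((n%:R *: ('X - 1)) ^+ j) (indicator_bfun B) 0.
have aj j : `|a j| <= (2 * n%:R) ^+ j.
  by rewrite -[leRHS]mulr1; apply: norm_le_exponent; exact:
    bounded_by_indicator.
have c0 : 0 <= 2 * n%:R :> R by rewrite mulr_ge0.
have [|cu le] := @exp_series_limit R a (2 * n%:R)
    (polyact T 'X^n (indicator_bfun B) 0) K n c0 aj.
  move=> m nm; have m0 : 0 < m%:R :> R by rewrite ltr0n (leq_trans _ nm).
  (* The success probability whose mean is [n]; it is at most [1] because [n < m]. *)
  pose t : R := n%:R / m%:R.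
  have t01 : 0 < t <= 1 by rewrite divr_gt0//= ler_pdivrMr// mul1r ler_nat ltnW.
  have mt : m%:R * t = n%:R by rewrite /t mulrC divfK// gt_eqF.
  have := HK _ _ t01 mt _ _ (@bounded_by_indicator B) 0; rewrite mulr1.
  apply: le_trans; rewrite polyactD polyactN bfunDE bfunNE.
  rewrite le_eqVlt; apply/orP; left; apply/eqP; congr `| _ - _|.
  (* The binomial theorem with [t^i = n^i / m^i] yields the sum in [exp_series_limit]. *)
  rewrite exprDn polyact_sum bfun_sumE; apply: eq_bigr => i _.
  rewrite /a -[LHS]bfunZE -polyactZ; congr (bfun_val (polyact T _ _) 0).
  rewrite expr1n mul1r !exprZn scalerA -[RHS]scaler_nat scalerA; congr (_ *: _).
  by rewrite exprVn /GRing.scale /=; ring.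
rewrite conv_pow_F /conv_exp.
have -> : (fun N => \sum_(0 <= j < N) ((j`!%:R)^-1)%:E *
    conv_pow (accompanying_exponent F n) j B)%E =
    EFin \o series (fun j => (j`!%:R)^-1 * a j).
  apply/funext => N; rewrite /series /= -sumEFin; apply: eq_bigr => j _.
  by rewrite conv_pow_exponent EFinM.
by rewrite EFin_lim// -EFinB abse_EFin lee_fin.
Qed.

End Bridge.

Local Open Scope ereal_scope.

(** * Assembly of the total variation bound *)

Theorem mainTheorem2 (R : realType) :
  exists C : R, (0 < C)%R /\
    forall (d : nat) (F : probability (Rd R d) R) (q : R),
      (0 < d)%N ->
      symmetric_on_lattice F ->
      supp F `<=` @lattice R d ->
      F [set (0%R : 'rV[R]_d)] = q%:E ->
      (0 < q < 1)%R ->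
      forall n : nat, (0 < n)%N ->
        dTV (conv_pow (charge_of_finite_measure F) n)
            (conv_exp (accompanying_exponent F n))
        <= C%:E * (1 + delta F n%:R ^+ 2) * ((n%:R * q `^ (7 / 2))^-1)%:E.
Proof.
(* [32] is the constant of [binomial_vs_power], used with [D = delta / q]. *)
exists 32%R; split=> // d F q _ symF suppF Fq q01 n n0.
have mq : mass F 0%R = q by rewrite /mass Fq.
have n0' : (0 < n%:R :> R)%R by rewrite ltr0n.
have [q0 q1] := andP q01.
(* As [q < 1], the larger exponent gives the smaller power, so a bound with [q ^+ 2] implies the one
   with exponent [7 / 2]. *)
have qpow : (0 < q `^ (7 / 2) <= q ^+ 2)%R.
  rewrite powR_gt0//= -powR_mulrn; last exact: ltW.
  have q01' : (0 < q <= 1)%R by rewrite q0 ltW.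
  have h : (2 <= 7 / 2 :> R)%R by lra.
  exact: (ger_powR q01' h).
have [qp0 qp2] := andP qpow.
have nq0 : (0 < (n%:R * q `^ (7 / 2))^-1)%R by rewrite invr_gt0 mulr_gt0.
have : 0 <= delta F n%:R.
  by apply: esum_ge0 => x _; rewrite lee_fin le_min ler01 !mulr_ge0 ?fine_ge0.
case dF : (delta F n%:R) => [r| |] // r0; last first.
  (* An infinite [delta] makes the right-hand side infinite. *)
  by rewrite expe2 mulyy addey// gt0_muley ?lte_fin// gt0_mulye ?lte_fin// leey.
have {}r0 : (0 <= r)%R by rewrite -lee_fin.
apply: ge_ereal_sup => _ [B mB <-].
have mq01 : (0 < mass F 0 < 1)%R by rewrite mq.
have bound m t : (0 < t <= 1)%R -> (m%:R * t = n%:R)%R ->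
    norm_le (polyact (avg suppF) ('X^n - (1 + t *: ('X - 1)) ^+ m)%R)
      (32 * (r / q) ^+ 2 / n%:R)%R.
  move=> t01 mt; apply: (binomial_vs_power (norm_le_avg suppF) n0 t01 mt).
    by rewrite divr_ge0// ltW.
  by move=> k kn; rewrite -mq; exact: (norm_le_avg_sub1 suppF symF mq01 n0 kn
    dF).
apply: (le_trans (conv_exp_bound B bound n0)).
rewrite -EFin_expe -EFinD -!EFinM lee_fin.
have -> : (32 * (r / q) ^+ 2 / n%:R = 32 * r ^+ 2 * (n%:R * q ^+ 2)^-1)%R.
  by field; rewrite !gt_eqF.
apply: ler_pM.
- by rewrite mulr_ge0// exprn_ge0.
- by rewrite invr_ge0 mulr_ge0 ?exprn_ge0// ltW.
- by rewrite ler_wpM2l// lerDr.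
- by rewrite lef_pV2 ?posrE ?mulr_gt0 ?exprn_gt0// ler_wpM2l// ltW.
Qed.
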